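(* Let $r\ge 1$ and $n\ge 2r$ be integers. For an arbitrary instance $\mathcal{P}_{\mathbf{M}^*,\Omega,n,r}$ in the low-complexity class $\mathcal{L}(\mathcal{G},n,r)$, the ground truth $\mathbf{M}^*$ is the unique solution of this problem and can be found in $\mathcal{O}(n^2/r^2+nr^2)$ time.
   Context: $[m]=\{1,\dots,m\}$; $\mathbb{S}^n_+$ is the set of $n\times n$ real positive semidefinite (PSD) matrices. For $\Omega\subset[n]\times[n]$, $\mathbf{M}_\Omega$ denotes the matrix whose $(i,j)$ entry is $\mathbf{M}_{ij}$ if $(i,j)\in\Omega$ and $0$ otherwise. The matrix completion problem $\mathcal{P}_{\mathbf{M}^*,\Omega,n,r}$ is: find $\mathbf{M}\in\mathbb{R}^{n\times n}$ such that $\mathrm{rank}(\mathbf{M})\le r$, $\mathbf{M}\succeq 0$, $\mathbf{M}_\Omega=\mathbf{M}^*_\Omega$. Let $m:=\lfloor n/r\rfloor\ge 2$. The first $mr$ rows and columns of an $n\times n$ matrix $\mathbf{M}^*$ are divided into $m\times m$ blocks of size $r\times r$; the block at position $(i,j)$ is denoted $\mathbf{M}^*_{i,j}$. Induced measurement set: let $\mathcal{G}=(\mathcal{G}_1,\mathcal{G}_2)=(\mathcal{V},\mathcal{E}_1,\mathcal{E}_2)$ be a pair of undirected graphs (self-loops allowed) on the node set $\mathcal{V}=[m]$ with disjoint edge sets $\mathcal{E}_1,\mathcal{E}_2\subset[m]\times[m]$, $\mathcal{G}_1=(\mathcal{V},\mathcal{E}_1)$, $\mathcal{G}_2=(\mathcal{V},\mathcal{E}_2)$.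 The set $\Omega(\mathcal{G})$ is: if $(i,j)\in\mathcal{E}_1$, all entries of block $(i,j)$ are observed; if $(i,j)\in\mathcal{E}_2$, all nondiagonal entries of the block $(i,j)$ are observed; otherwise no entry of the block is observed; in addition, the last $n-mr$ rows and columns are fully observed. The class $\mathcal{L}(\mathcal{G},n,r)$ consists of the problems $\mathcal{P}_{\mathbf{M}^*,\Omega,n,r}$ such that: (i) $\mathbf{M}^*\in\mathbb{S}^n_+$ has rank $r$; (ii) $\mathbf{M}^*_{i,j}\in\mathbb{R}^{r\times r}$ has rank $r$ for all $i,j\in[m]$; (iii) $\Omega=\Omega(\mathcal{G})$ with $\mathcal{G}_1$ connected and non-bipartite (a self-loop counts as an odd cycle). *)

(* Defs.v *)
From mathcomp Require Import all_boot all_order all_algebra reals.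

Set Implicit Arguments.
Unset Strict Implicit.
Unset Printing Implicit Defensive.

Import Order.TTheory GRing.Theory Num.Theory.
Local Open Scope ring_scope.

Definition psd (R : realType) (n : nat) (M : 'M[R]_n) : Prop :=
  M^T = M /\ forall x : 'cV[R]_n, 0 <= (x^T *m M *m x) ord0 ord0.

Definition mask (R : realType) (n : nat) (Omega : {set 'I_n * 'I_n})
    (M : 'M[R]_n) : 'M[R]_n :=
  \matrix_(i, j) if (i, j) \in Omega then M i j else 0.

Definition solution (R : realType) (n : nat) (Mstar : 'M[R]_n)
    (Omega : {set 'I_n * 'I_n}) (r : nat) (M : 'M[R]_n) : Prop :=
  [/\ (\rank M <= r)%N, psd M & mask Omega M = mask Omega Mstar].

Lemma block_idx_subproof (n r : nat) (i : 'I_(n %/ r)) (a : 'I_r) :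
  (i * r + a < n)%N.
Proof.
apply: leq_trans (leq_divM n r); apply: (@leq_trans (i.+1 * r)).
  by rewrite mulSn addnC ltn_add2r.
by rewrite leq_mul2r ltn_ord orbT.
Qed.

Definition block_idx (n r : nat) (i : 'I_(n %/ r)) (a : 'I_r) : 'I_n :=
  Ordinal (block_idx_subproof i a).

Definition block (R : realType) (n r : nat) (M : 'M[R]_n)
    (i j : 'I_(n %/ r)) : 'M[R]_r :=
  \matrix_(a, b) M (block_idx i a) (block_idx j b).

(* An undirected edge set is a symmetric set of ordered pairs; the pairs (i, i)
   are self-loops. *)
Record graph_pair (m : nat) := GraphPair {
  edges1 : {set 'I_m * 'I_m};
  edges2 : {set 'I_m * 'I_m};
  edges1_sym : forall i j, ((i, j) \in edges1) = ((j, i) \in edges1);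
  edges2_sym : forall i j, ((i, j) \in edges2) = ((j, i) \in edges2);
  edges_disjoint : [disjoint edges1 & edges2]
}.

Definition graph_connected (m : nat) (E : {set 'I_m * 'I_m}) : Prop :=
  forall i j : 'I_m, connect [rel x y | (x, y) \in E] i j.

Definition bipartite (m : nat) (E : {set 'I_m * 'I_m}) : Prop :=
  exists side : 'I_m -> bool, forall i j, (i, j) \in E -> side i != side j.

Definition induced_measurements (n r : nat) (G : graph_pair (n %/ r)) :
    {set 'I_n * 'I_n} :=
  [set kl : 'I_n * 'I_n |
    [|| (n %/ r * r <= kl.1)%N, (n %/ r * r <= kl.2)%N |
     [exists i : 'I_(n %/ r), exists j : 'I_(n %/ r),
      exists a : 'I_r, exists b : 'I_r,
        (kl == (block_idx i a, block_idx j b)) &&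
        (((i, j) \in edges1 G) || ((i, j) \in edges2 G) && (a != b))]]].

Definition low_complexity (R : realType) (n r : nat) (G : graph_pair (n %/ r))
    (Mstar : 'M[R]_n) (Omega : {set 'I_n * 'I_n}) : Prop :=
  [/\ psd Mstar /\ \rank Mstar = r,
      forall i j : 'I_(n %/ r), \rank (block Mstar i j) = r,
      Omega = induced_measurements G,
      graph_connected (edges1 G)
    & ~ bipartite (edges1 G)].

(* The machine model is a unit-cost real RAM with structured control flow. All
   arguments of instructions and tests are names of registers or arrays, except
   the constant c of [IConst] and [RConst]; array indices and matrix positions
   are read from integer registers. A program names finitely many registers and
   two-dimensional arrays. Integers have no multiplication or division, so that
   one step at most doubles the largest integer present and long integers do not
   grow as fast as they would by repeated squaring. Division by 0 gives 0. *)

Inductive real_op := RAdd | RSub | RMul | RDiv.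

Inductive instr :=
| IConst (x c : nat)            (* integer register x := c *)
| IAdd (x y z : nat)            (* integer register x := y + z *)
| ISub (x y z : nat)            (* integer register x := y - z, truncated *)
| ILoad (x arr i j : nat)       (* integer register x := arr[i, j] *)
| IStore (arr i j x : nat)      (* arr[i, j] := integer register x *)
| RConst (x c : nat)            (* real register x := c *)
| ROp (o : real_op) (x y z : nat)
| RLoad (x arr i j : nat)
| RStore (arr i j x : nat)
| RInput (x i j : nat).         (* real register x := measured entry (i, j) *)

Inductive test :=
| TIntLt (x y : nat)
| TRealLe (x y : nat)
| TObserved (i j : nat).        (* is entry (i, j) in the measurement set *)

Inductive program :=
| Skip
| Do (a : instr)
| Seq (p q : program)
| If (b : test) (p q : program)
| While (b : test) (p : program).

Record state (R : realType) := State {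
  ireg : nat -> nat;
  iarr : nat -> nat -> nat -> nat;
  rreg : nat -> R;
  rarr : nat -> nat -> nat -> R
}.

Definition upd (T : Type) (f : nat -> T) (x : nat) (v : T) : nat -> T :=
  fun y => if y == x then v else f y.

Definition upd_arr (T : Type) (f : nat -> nat -> nat -> T) (arr i j : nat)
    (v : T) : nat -> nat -> nat -> T :=
  upd f arr (upd (f arr) i (upd (f arr i) j v)).

Definition eval_real_op (R : realType) (o : real_op) (x y : R) : R :=
  match o with
  | RAdd => x + y
  | RSub => x - y
  | RMul => x * y
  | RDiv => x / y
  end.

Definition observed (n : nat) (Omega : {set 'I_n * 'I_n}) (k l : nat) : bool :=
  [exists ij in Omega, (k == ij.1 :> nat) && (l == ij.2 :> nat)].

Definition entry (R : realType) (n : nat) (A : 'M[R]_n) (k l : nat) : R :=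
  match insub k, insub l with
  | Some i, Some j => A i j
  | _, _ => 0
  end.

Definition eval_instr (R : realType) (n : nat) (A : 'M[R]_n) (a : instr)
    (s : state R) : state R :=
  let: State ir ia rr ra := s in
  match a with
  | IConst x c => State (upd ir x c) ia rr ra
  | IAdd x y z => State (upd ir x (ir y + ir z)%N) ia rr ra
  | ISub x y z => State (upd ir x (ir y - ir z)%N) ia rr ra
  | ILoad x arr i j => State (upd ir x (ia arr (ir i) (ir j))) ia rr ra
  | IStore arr i j x => State ir (upd_arr ia arr (ir i) (ir j) (ir x)) rr ra
  | RConst x c => State ir ia (upd rr x c%:R) ra
  | ROp o x y z => State ir ia (upd rr x (eval_real_op o (rr y) (rr z))) ra
  | RLoad x arr i j => State ir ia (upd rr x (ra arr (ir i) (ir j))) ra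
  | RStore arr i j x => State ir ia rr (upd_arr ra arr (ir i) (ir j) (rr x))
  | RInput x i j => State ir ia (upd rr x (entry A (ir i) (ir j))) ra
  end.

Definition eval_test (R : realType) (n : nat) (Omega : {set 'I_n * 'I_n})
    (b : test) (s : state R) : bool :=
  match b with
  | TIntLt x y => (ireg s x < ireg s y)%N
  | TRealLe x y => rreg s x <= rreg s y
  | TObserved i j => observed Omega (ireg s i) (ireg s j)
  end.

(* [exec Omega A p s t s']: from state s the program p halts in state s' after
   t time units, the measurements being (Omega, A). Every instruction and every
   evaluation of a test takes one time unit. *)
Inductive exec (R : realType) (n : nat) (Omega : {set 'I_n * 'I_n})
    (A : 'M[R]_n) : program -> state R -> nat -> state R -> Prop :=
| ExecSkip s : exec Omega A Skip s 1 s
| ExecDo a s : exec Omega A (Do a) s 1 (eval_instr A a s)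
| ExecSeq p q s1 s2 s3 t1 t2 :
    exec Omega A p s1 t1 s2 -> exec Omega A q s2 t2 s3 ->
    exec Omega A (Seq p q) s1 (t1 + t2) s3
| ExecIfTrue b p q s t s' :
    eval_test Omega b s -> exec Omega A p s t s' ->
    exec Omega A (If b p q) s t.+1 s'
| ExecIfFalse b p q s t s' :
    ~~ eval_test Omega b s -> exec Omega A q s t s' ->
    exec Omega A (If b p q) s t.+1 s'
| ExecWhileFalse b p s :
    ~~ eval_test Omega b s -> exec Omega A (While b p) s 1 s
| ExecWhileTrue b p s1 s2 s3 t1 t2 :
    eval_test Omega b s1 -> exec Omega A p s1 t1 s2 ->
    exec Omega A (While b p) s2 t2 s3 ->
    exec Omega A (While b p) s1 (t1 + t2).+1 s3.

Definition init_state (R : realType) (n r : nat) : state R :=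
  State (fun x => match x with 0 => n | 1 => r | _ => 0 end)%N
        (fun _ _ _ => 0%N) (fun _ => 0) (fun _ _ _ => 0).

Definition output_mx (R : realType) (n r arr : nat) (s : state R) :
    'M[R]_(n, r) :=
  \matrix_(k, a) rarr s arr k a.

(* On the problem with measurements [mask Omega Mstar], the program p halts
   after t time units with n x r matrices X and Y in the real arrays 0 and 1
   such that Mstar = X Y^T. The result is in factored form because writing the
   n^2 entries of an n x n matrix would by itself exceed a bound such as
   n^2/r^2 + n r^2. The program sees Mstar only through its masked entries. *)
Definition finds_in (R : realType) (n r : nat) (p : program)
    (Omega : {set 'I_n * 'I_n}) (Mstar : 'M[R]_n) (t : nat) : Prop :=
  exists s : state R,
    exec Omega (mask Omega Mstar) p (init_state R n r) t s /\
    output_mx n r 0 s *m (output_mx n r 1 s)^T = Mstar.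

(* Main.v *)
Require Import Defs.
From mathcomp Require Import all_boot all_order all_algebra reals.
From mathcomp Require Import zify.

Set Implicit Arguments.
Unset Strict Implicit.
Unset Printing Implicit Defensive.

Import Order.TTheory GRing.Theory Num.Theory.
Local Open Scope ring_scope.

(* Factor a symmetric M of rank at most r as T0 T1^T with n x r factors. The
   factors are unique up to (T0, T1) -> (T0 Q, T1 Q^-T), hence unique once the
   first r x r block of T0 is the identity. A fully observed block (i, j) with
   invertible row block i of T_p then determines row block j of T_(1-p), by the
   linear system T_p(i) T_(1-p)(j)^T = M(i, j). Starting from (0, 0), these steps
   reach every pair (j, q): the bipartite double cover of a connected graph is
   connected when the graph is not bipartite. So any symmetric M of rank at most
   r with the observed entries is the ground truth, and a breadth-first search in
   the double cover finds T0 and T1 with two r x r solves per node, recognizing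
   the edges of the first graph by the observed corner entry of a block.

   The linear systems are solved without pivoting or square roots: with H the
   orthogonal projection with kernel spanned by the rows a_0, ..., a_(k-1), the step
   x += (b_k - a_k x) / (a_k H a_k^T) H a_k^T satisfies equation k, keeps the
   previous ones, and its denominator |a_k H|^2 is nonzero by independence. *)

(** * Reasoning about programs with a time budget *)

Inductive store := IReg | IArr | RReg | RArr.

Definition instr_writes (a : instr) (o : store) (y : nat) : bool :=
  match a, o with
  | (IConst x _ | IAdd x _ _ | ISub x _ _ | ILoad x _ _ _), IReg => y == x
  | IStore arr _ _ _, IArr => y == arr
  | (RConst x _ | ROp _ x _ _ | RLoad x _ _ _ | RInput x _ _), RReg => y == x
  | RStore arr _ _ _, RArr => y == arr
  | _, _ => false
  end.

(** A syntactic over-approximation that treats each array as a whole. Being computable, it lets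
    frame side conditions close by evaluation. *)
Fixpoint writes (p : program) (o : store) (y : nat) : bool :=
  match p with
  | Skip => false
  | Do a => instr_writes a o y
  | Seq p q | If _ p q => writes p o y || writes q o y
  | While _ p => writes p o y
  end.

Section Logic.
Local Open Scope nat_scope.
Variables (R : realType) (n : nat) (Omega : {set 'I_n * 'I_n}) (A : 'M[R]_n).
Implicit Types (p q : program) (s : state R) (k t : nat).
Implicit Type Q : state R -> nat -> Prop.

Definition frame p s s' : Prop :=
  [/\ forall x, ~~ writes p IReg x -> ireg s' x = ireg s x,
      forall x, ~~ writes p IArr x -> iarr s' x = iarr s x,
      forall x, ~~ writes p RReg x -> rreg s' x = rreg s x
    & forall x, ~~ writes p RArr x -> rarr s' x = rarr s x].

Lemma frame_ireg p s s' x :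
  frame p s s' -> ~~ writes p IReg x -> ireg s' x = ireg s x.
Proof. by case=> + _ _ _; apply. Qed.

Lemma frame_iarr p s s' x :
  frame p s s' -> ~~ writes p IArr x -> iarr s' x = iarr s x.
Proof. by case=> _ + _ _; apply. Qed.

Lemma frame_rreg p s s' x :
  frame p s s' -> ~~ writes p RReg x -> rreg s' x = rreg s x.
Proof. by case=> _ _ + _; apply. Qed.

Lemma frame_rarr p s s' x :
  frame p s s' -> ~~ writes p RArr x -> rarr s' x = rarr s x.
Proof. by case=> _ _ _; apply. Qed.

Lemma frame_trans p s1 s2 s3 : frame p s1 s2 -> frame p s2 s3 -> frame p s1 s3.
Proof.
move=> [i1 a1 r1 b1] [i2 a2 r2 b2].
by split=> x Hx; rewrite ?i2 ?a2 ?r2 ?b2 // ?i1 ?a1 ?r1 ?b1.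
Qed.

Lemma frame_sub p q s s' :
  (forall o x, writes p o x -> writes q o x) -> frame p s s' -> frame q s s'.
Proof.
move=> sub [fi fa fr fb]; split=> x /negP Hx.
- by apply/fi/negP => /sub.
- by apply/fa/negP => /sub.
- by apply/fr/negP => /sub.
- by apply/fb/negP => /sub.
Qed.

Lemma exec_frame p s t s' : exec Omega A p s t s' -> frame p s s'.
Proof.
elim=> {p s t s'} //.
- case=> [x c|x y z|x y z|x arr i j|arr i j x|x c|o x y z|x arr i j|arr i j x|x i j];
    by case=> ir ia rr ra; split=> y' //= /negbTE H; rewrite /upd_arr /upd ?H.
- move=> p q s1 s2 s3 _ _ _ F1 _ F2.
  apply: (@frame_trans _ _ s2).
    by apply: frame_sub F1 => o x /= ->.
  by apply: frame_sub F2 => o x /= ->; rewrite orbT.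
- by move=> b p q s t s' _ _ F; apply: frame_sub F => o x /= ->.
- by move=> b p q s t s' _ _ F; apply: frame_sub F => o x /= ->; rewrite orbT.
- move=> b p s1 s2 s3 _ _ _ _ F1 _ F2.
  exact: frame_trans F1 F2.
Qed.

(* [Q] receives the unspent part of the budget [k], so that amortized time
   bounds can be part of loop invariants. *)
Definition wp p s k Q : Prop :=
  exists t s', [/\ exec Omega A p s t s', (t <= k)%N & Q s' (k - t)%N].

Lemma wp_frame p s k Q :
  wp p s k (fun s' k' => frame p s s' -> Q s' k') -> wp p s k Q.
Proof.
move=> [t [s' [E le_tk H]]]; exists t, s'; split=> //.
by apply: H; apply: exec_frame E.
Qed.

Lemma wp_conseq p s k Q1 Q2 :
  wp p s k Q1 -> (forall s' k', frame p s s' -> Q1 s' k' -> Q2 s' k') ->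
  wp p s k Q2.
Proof.
move=> [t [s' [E le_tk H]]] H12; exists t, s'; split=> //.
by apply: H12 => //; apply: exec_frame E.
Qed.

Lemma wp_skip s k Q : (0 < k)%N -> Q s k.-1 -> wp Skip s k Q.
Proof. by move=> k0 H; exists 1, s; split=> //; [constructor | rewrite subn1]. Qed.

(** [eval_instr] matches on the state and is stuck on a variable; this form uses projections and
    reduces for every state. *)
Definition eval_step (a : instr) s : state R :=
  match a with
  | IConst x c => State (upd (ireg s) x c) (iarr s) (rreg s) (rarr s)
  | IAdd x y z =>
      State (upd (ireg s) x (ireg s y + ireg s z)%N) (iarr s) (rreg s) (rarr s)
  | ISub x y z =>
      State (upd (ireg s) x (ireg s y - ireg s z)%N) (iarr s) (rreg s) (rarr s)
  | ILoad x arr i j =>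
      State (upd (ireg s) x (iarr s arr (ireg s i) (ireg s j))) (iarr s) (rreg s) (rarr s)
  | IStore arr i j x =>
      State (ireg s) (upd_arr (iarr s) arr (ireg s i) (ireg s j) (ireg s x)) (rreg s) (rarr s)
  | RConst x c => State (ireg s) (iarr s) (upd (rreg s) x c%:R%R) (rarr s)
  | ROp o x y z =>
      State (ireg s) (iarr s) (upd (rreg s) x (eval_real_op o (rreg s y) (rreg s z))) (rarr s)
  | RLoad x arr i j =>
      State (ireg s) (iarr s) (upd (rreg s) x (rarr s arr (ireg s i) (ireg s j))) (rarr s)
  | RStore arr i j x =>
      State (ireg s) (iarr s) (rreg s) (upd_arr (rarr s) arr (ireg s i) (ireg s j) (rreg s x))
  | RInput x i j =>
      State (ireg s) (iarr s) (upd (rreg s) x (entry A (ireg s i) (ireg s j))) (rarr s)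
  end.

Lemma eval_stepE a s : eval_instr A a s = eval_step a s.
Proof. by case: s; case: a. Qed.

Lemma wp_do a s k Q : (0 < k)%N -> Q (eval_step a s) k.-1 -> wp (Do a) s k Q.
Proof.
move=> k0 H; exists 1, (eval_instr A a s); split=> //; first by constructor.
by rewrite subn1 eval_stepE.
Qed.

Lemma wp_seq p q s k Q :
  wp p s k (fun s' k' => wp q s' k' Q) -> wp (Seq p q) s k Q.
Proof.
move=> [t1 [s1 [E1 le1 [t2 [s2 [E2 le2 H]]]]]].
exists (t1 + t2)%N, s2; split; first exact: ExecSeq E1 E2.
  by lia.
by rewrite subnDA.
Qed.

Lemma wp_if b p q s k Q : (0 < k)%N ->
  (eval_test Omega b s -> wp p s k.-1 Q) ->
  (~~ eval_test Omega b s -> wp q s k.-1 Q) -> wp (If b p q) s k Q.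
Proof.
move=> k0 Hp Hq; have [Hb|Hb] := boolP (eval_test Omega b s).
  have [t [s' [E le_tk H]]] := Hp Hb.
  exists t.+1, s'; split; [exact: ExecIfTrue | lia |].
  by rewrite -subn1 -subnDA in H.
have [t [s' [E le_tk H]]] := Hq Hb.
exists t.+1, s'; split; [exact: ExecIfFalse | lia |].
by rewrite -subn1 -subnDA in H.
Qed.

(* Each iteration spends at least one time unit, so the budget is a variant. *)
Lemma wp_while b p s k Q (I : state R -> nat -> Prop) :
  I s k ->
  (forall s' k', I s' k' -> (0 < k')%N) ->
  (forall s' k', frame p s s' -> I s' k' -> ~~ eval_test Omega b s' -> Q s' k'.-1) ->
  (forall s' k', frame p s s' -> I s' k' -> eval_test Omega b s' -> wp p s' k'.-1 I) ->
  wp (While b p) s k Q.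
Proof.
move=> Isk I0 HQ HI.
have: frame p s s by [].
(* Only the current state is generalized: the first argument of [frame] stays the state at loop
   entry. *)
elim/ltn_ind: k {1 3 4}s Isk => k IH s' Isk F.
have k0 := I0 _ _ Isk.
have [Hb|Hb] := boolP (eval_test Omega b s'); last first.
  exists 1, s'; split=> //; first by constructor.
  by rewrite subn1; apply: HQ.
have [t1 [s1 [E1 le1 I1]]] := HI _ _ F Isk Hb.
have F1 := frame_trans F (exec_frame E1).
have [|t2 [s2 [E2 le2 H]]] := IH _ _ s1 I1 F1; first by lia.
exists (t1 + t2).+1, s2; split; first exact: ExecWhileTrue Hb E1 E2.
  by lia.
by have -> : (k - (t1 + t2).+1 = k.-1 - t1 - t2)%N by lia.
Qed.

End Logic.

(* Integer registers 2 and 3 are assumed to hold 0 and 1. *)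
Definition For (x lo hi : nat) (body : program) : program :=
  Seq (Do (IAdd x lo 2)) (While (TIntLt x hi) (Seq body (Do (IAdd x x 3)))).

Section ForLoop.
Local Open Scope nat_scope.
Variables (R : realType) (n : nat) (Omega : {set 'I_n * 'I_n}) (A : 'M[R]_n).
Notation wp := (@wp R n Omega A).

(** An iteration costs [c] for the body plus the test and the increment; the final 2 pays for
    initialization and the failing test. Beyond the counter, the invariant speaks only of real data;
    facts on integer registers come from the frame. *)
Lemma wp_for (x lo hi : nat) body c (s : state R) k
    (I : nat -> (nat -> R) -> (nat -> nat -> nat -> R) -> Prop) Q :
  x \notin [:: hi; 2; 3] ->
  all (fun y => ~~ writes body IReg y) [:: x; hi; 2; 3] ->
  ireg s 2 = 0%N -> ireg s 3 = 1%N -> (ireg s lo <= ireg s hi)%N ->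
  I (ireg s lo) (rreg s) (rarr s) ->
  ((ireg s hi - ireg s lo) * (c + 2) + 2 <= k)%N ->
  (forall v s' k', frame (For x lo hi body) s s' -> ireg s' x = v ->
     (ireg s lo <= v < ireg s hi)%N -> I v (rreg s') (rarr s') -> (c <= k')%N ->
     wp body s' k' (fun s'' k'' =>
        (k' <= k'' + c)%N /\ I v.+1 (rreg s'') (rarr s''))) ->
  (forall s' k', frame (For x lo hi body) s s' ->
     I (ireg s hi) (rreg s') (rarr s') ->
     (k <= k' + ((ireg s hi - ireg s lo) * (c + 2) + 2))%N -> Q s' k') ->
  wp (For x lo hi body) s k Q.
Proof.
move=> xn /and5P[bx bh b2 b3 _] s2 s3 le I0 lek HB HQ.
have [xh x2 x3] : [/\ x != hi, x != 2 & x != 3].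
  by move: xn; rewrite !inE !negb_or => /and3P[].
apply: wp_frame; apply: wp_seq; apply: wp_do; first by apply: leq_trans lek; rewrite addn2.
set s1 := eval_step A _ s.
have s1x : ireg s1 x = ireg s lo by rewrite /s1 /= /upd eqxx s2 addn0.
have s1y y : y != x -> ireg s1 y = ireg s y by rewrite /s1 /= /upd => /negbTE->.
have F1 : frame (For x lo hi body) s s1.
  by split=> y //=; rewrite negb_or => /andP[/negbTE Hy _]; rewrite /upd Hy.
(* The budget is bounded in both directions: one inequality limits what has been spent, for the
   postcondition; the other keeps enough for the remaining iterations. *)
pose J (s' : state R) k' := [/\ (ireg s lo <= ireg s' x <= ireg s hi)%N,
   I (ireg s' x) (rreg s') (rarr s') &
   (k <= k' + ((ireg s' x - ireg s lo) * (c + 2) + 1) /\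
    (ireg s hi - ireg s' x) * (c + 2) + 1 <= k')%N].
apply: (@wp_while _ _ _ _ _ _ _ _ _ J).
- split; rewrite s1x; [lia | exact: I0 | idtac].
  by move: lek; rewrite subnn mul0n; move: (_ * _) => N; lia.
- by move=> s' k' [_ _ [_]]; rewrite addn1; apply: leq_trans.
- move=> s' k' F [lex Is' [lek1 lek2]] Ht.
  have s'h : ireg s' hi = ireg s hi.
    rewrite (frame_ireg F) ?s1y 1?eq_sym //=.
    by rewrite negb_or bh /= eq_sym.
  rewrite /= s'h -leqNgt in Ht.
  have Ex : ireg s' x = ireg s hi by lia.
  move=> Fr; apply: HQ => //; first by rewrite -Ex.
  by move: lek1 lek2; rewrite Ex subnn mul0n; move: (_ * _) => N; lia.
- move=> s' k' F [lex Is' [lek1 lek2]] Ht.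
  have [s'h s'2 s'3] : [/\ ireg s' hi = ireg s hi, ireg s' 2 = 0%N & ireg s' 3 = 1%N].
    split; rewrite (frame_ireg F) ?s1y 1?eq_sym //= negb_or ?bh ?b2 ?b3 //= eq_sym //.
  have F' : frame (For x lo hi body) s s'.
    apply: frame_trans F1 _; apply: frame_sub F => o y /= /orP[]->; by rewrite ?orbT.
  rewrite /= s'h in Ht.
  have [N EN] : exists N, (ireg s hi - ireg s' x = N.+1)%N.
    by exists (ireg s hi - ireg s' x).-1; lia.
  rewrite EN mulSn in lek2.
  apply: wp_seq; apply: wp_conseq.
    apply: (HB (ireg s' x)) => //; first by lia.
    by move: lek2; move: (N * _) => M; lia.
  move=> s2' k2 F2 [le2 I2]; apply: wp_do.
    by move: lek2; move: (N * _) => M; lia.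
  have E : (ireg s2' x + ireg s2' 3 = (ireg s' x).+1)%N.
    by rewrite !(frame_ireg F2) // s'3 addn1.
  split; rewrite /= /upd eqxx E //; first by lia.
  have EN' : (ireg s hi - (ireg s' x).+1 = N)%N by lia.
  rewrite EN'.
  have -> : ((ireg s' x).+1 - ireg s lo = (ireg s' x - ireg s lo).+1)%N by lia.
  by move: lek1 lek2; rewrite mulSn; move: (_ * _) (N * _) => M1 M2; lia.
Qed.

End ForLoop.

(** * Projections *)

(* [H] is the orthogonal projection whose kernel is spanned by the first [k]
   rows of [B]. *)
Definition is_projector (F : realFieldType) (r : nat) (B : 'M[F]_r) (k : nat)
    (H : 'M[F]_r) : Prop :=
  [/\ H^T = H, H *m H = H,
      forall j : 'I_r, (j < k)%N -> row j B *m H = 0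
    & exists2 C : 'M[F]_r, 1%:M - H = C *m B
        & forall i j : 'I_r, (k <= j)%N -> C i j = 0].

Lemma is_projector0 (F : realFieldType) (r : nat) (B : 'M[F]_r) :
  is_projector B 0 1%:M.
Proof.
split; rewrite ?trmx1 ?mulmx1 //.
by exists 0; [rewrite mul0mx subrr | move=> i j _; rewrite mxE].
Qed.

Lemma mulmx_tr_eq0 (F : realFieldType) (r : nat) (v : 'rV[F]_r) :
  (v *m v^T) 0 0 = 0 -> v = 0.
Proof.
move=> v0; apply/rowP => j; rewrite mxE.
have : \sum_i v 0 i ^+ 2 = 0.
  apply: etrans v0; rewrite mxE; apply: eq_bigr => i _; by rewrite mxE expr2.
move/eqP; rewrite psumr_eq0 => [/allP/(_ j)|i _]; last exact: sqr_ge0.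
by rewrite mem_index_enum sqrf_eq0 => /(_ isT)/eqP.
Qed.

(** With b the row [k], symmetry and idempotence of H give d = -|bH|^2, so the update subtracts the
    orthogonal projection onto the line of bH. The last claim keeps earlier equations satisfied when
    an unknown moves along [s]. *)
Lemma projector_step (F : realFieldType) (r : nat) (B H : 'M[F]_r) (k : 'I_r)
    (s := - (row k B *m H)) (d := (row k B *m s^T) 0 0) :
  B \in unitmx -> is_projector B k H ->
  [/\ d != 0, is_projector B k.+1 (H + d^-1 *: (s^T *m s))
    & forall j : 'I_r, (j < k)%N -> row j B *m s^T = 0].
Proof.
move=> uB [symH idH ann [C C1 Cz]].
have sT : s^T = - (H *m (row k B)^T) by rewrite /s linearN /= trmx_mul symH.
have sH : s *m H = s by rewrite /s mulNmx -mulmxA idH.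
have HsT : H *m s^T = s^T by rewrite sT mulmxN mulmxA idH.
have dE : d = - (s *m s^T) 0 0.
  have -> : s *m s^T = - (row k B *m s^T).
    by rewrite {1}/s mulNmx -mulmxA HsT.
  by rewrite [in RHS]mxE opprK.
have ann' (j : 'I_r) : (j < k)%N -> row j B *m s^T = 0.
  by move=> jk; rewrite sT mulmxN mulmxA ann // mul0mx oppr0.
have d0 : d != 0.
  apply/eqP => d0; have s0 : s = 0.
    by apply: mulmx_tr_eq0; apply/eqP; rewrite -oppr_eq0 -dE d0.
  (* If bH = 0 then b = (bC)B; cancelling the invertible [B] equates bC with the unit vector e_k,
     although coordinate [k] of bC is zero. *)
  have : row k B *m (1%:M - H) = row k B.
    by rewrite mulmxBr mulmx1; move/eqP: s0; rewrite oppr_eq0 => /eqP ->; rewrite subr0.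
  rewrite C1 mulmxA rowE => /(can_inj (mulmxK uB)) /rowP/(_ k).
  rewrite mxE big1 => [|j _]; last by rewrite Cz ?mulr0.
  by rewrite mxE !eqxx => /eqP; rewrite eq_sym oner_eq0.
split=> //.
have ss : s *m s^T = (- d)%:M by rewrite [LHS]mx11_scalar dE opprK.
split.
- by rewrite linearD linearZ /= trmx_mul trmxK symH.
- rewrite mulmxDl !mulmxDr idH -!scalemxAl -!scalemxAr.
  rewrite mulmxA HsT -(mulmxA s^T s H) sH -[s^T *m s *m _]mulmxA (mulmxA s s^T s) ss.
  rewrite mul_scalar_mx -scalemxAr (scalerA _ (- d)) mulrN mulVf // scaleN1r.
  by rewrite scalerN subrr addr0.
- move=> j; rewrite ltnS leq_eqVlt => /predU1P[/val_inj-> | jk].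
    rewrite mulmxDr -scalemxAr mulmxA [row k B *m s^T]mx11_scalar -/d.
    by rewrite mul_scalar_mx scalerA mulVf // scale1r /s subrr.
  by rewrite mulmxDr ann // -scalemxAr mulmxA ann' // mul0mx scaler0 addr0.
(* Since -bH = b(1 - H) - b, also [s] is a combination of rows 0 to [k]; this supplies the
   coefficient matrix of the new projection. *)
- have sE : s = (row k B *m C - delta_mx 0 k) *m B.
    by rewrite mulmxBl -mulmxA -C1 -rowE mulmxBr mulmx1 addrAC subrr add0r.
  exists (C - d^-1 *: (s^T *m (row k B *m C - delta_mx 0 k))).
    by rewrite opprD addrA C1 mulmxBl -scalemxAl -mulmxA -sE.
  move=> i j kj; rewrite !mxE Cz ?(ltnW kj) // big1 ?mulr0 ?subrr // => l _.
  rewrite [X in _ * X]mxE [X in _ * (X + _)]mxE big1 => [|h _]; last by rewrite Cz ?mulr0 ?(ltnW kj).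
  rewrite add0r [X in _ * X]mxE [X in _ * - X]mxE (_ : (j == k) = false).
    by rewrite andbF oppr0 mulr0.
  by apply/eqP => jk; move: kj; rewrite jk ltnn.
Qed.

(** * Normalized factorizations and uniqueness *)

Section RankFactor.
Variable F : fieldType.

Lemma rank_factor (n r : nat) (M : 'M[F]_n) :
  (\rank M <= r)%N -> exists U : 'M[F]_(n, r), exists V : 'M[F]_(n, r), M = U *m V^T.
Proof.
move=> le_r; exists (col_ebase M *m pid_mx (\rank M)).
exists (pid_mx (\rank M) *m row_ebase M)^T.
rewrite trmxK mulmxA -(mulmxA (col_ebase M)) mul_pid_mx.
have -> : minn r (minn (\rank M) (\rank M)) = \rank M by rewrite minnn; apply/minn_idPr.
by rewrite mulmx_ebase.
Qed.

End RankFactor.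

(** By connectedness every node has at least one level in [S]. If some node has both, walks carry
    both to every node; otherwise the level is a proper two-colouring, which is excluded. *)
Lemma double_cover_ind (m : nat) (E : {set 'I_m * 'I_m}) (S : pred ('I_m * bool)) i0 :
  (forall i j, ((i, j) \in E) = ((j, i) \in E)) ->
  graph_connected E -> ~ bipartite E -> S (i0, false) ->
  (forall i j q, S (i, q) -> (i, j) \in E -> S (j, ~~ q)) -> forall x, S x.
Proof.
move=> symE conE nbE S0 Sstep.
have step_path i j q : S (i, q) -> exists q', S (j, q') /\ (S (i, ~~ q) -> S (j, ~~ q')).
  have /connectP[p + ->] := conE i j.
  elim: p i q => [|h p IH] i q /=; first by move=> _ Siq; exists q.
  move=> /andP[ih /IH{}IH] Siq.
  have [q' [S1 S2]] := IH _ (Sstep _ _ _ Siq ih).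
  exists q'; split=> // Sinq; apply: S2; exact: Sstep ih.
have [/existsP[j /andP[Sj0 Sj1]] | none] := boolP [exists j, S (j, false) && S (j, true)].
  move=> [i q]; have [q' [S1 /(_ Sj1) S2]] := step_path j i _ Sj0.
  by case: q q' S1 S2 => [] [].
case: nbE; exists (fun j => S (j, true)) => i j ij.
have excl h : S (h, false) -> S (h, true) = false.
  by move=> H; apply/negP => H'; case/existsP: none; exists h; rewrite H H'.
have [q [Si _]] := step_path i0 i _ S0.
have := Sstep _ _ _ Si ij.
by case: q Si => /= [Si /excl->|/excl-> ->] //; rewrite Si.
Qed.

(** * Block indices and measured entries *)

Section Blocks.
Variables (R : realType) (n r : nat).
Local Notation m := (n %/ r)%N.

Definition row_block (T : 'M[R]_(n, r)) (i : 'I_m) : 'M[R]_r :=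
  rowsub (@block_idx n r i) T.

Lemma block_mul_tr (U V : 'M[R]_(n, r)) (i j : 'I_m) :
  block (U *m V^T) i j = row_block U i *m (row_block V j)^T.
Proof.
apply/matrixP => a b; rewrite !mxE; apply: eq_bigr => c _.
by rewrite !mxE.
Qed.

Variant index_spec (k : 'I_n) : Type :=
| IndexBlock j a of k = @block_idx n r j a
| IndexTail of (m * r <= k)%N.

Lemma indexP (k : 'I_n) : index_spec k.
Proof.
have [|km] := leqP (m * r)%N k; first exact: IndexTail.
have r0 : (0 < r)%N by case: r km => // /[!muln0].
have jm : (k %/ r < m)%N by rewrite ltn_divLR.
apply: (@IndexBlock k (Ordinal jm) (Ordinal (ltn_pmod k r0))).
by apply: val_inj; rewrite /= -divn_eq.
Qed.

Lemma block_idx_lt (i : 'I_m) (a : 'I_r) : (i * r + a < m * r)%N.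
Proof.
apply: (@leq_trans (i.+1 * r)); first by rewrite mulSn addnC ltn_add2r.
by rewrite leq_mul2r ltn_ord orbT.
Qed.

Lemma block_idx_inj (i j : 'I_m) (a b : 'I_r) :
  (i * r + a = j * r + b)%N -> i = j /\ a = b.
Proof.
move=> E; have r0 : (0 < r)%N by apply: leq_ltn_trans (ltn_ord a).
have Ea : a = b.
  apply: val_inj => /=; move/(congr1 (modn^~ r)): E.
  by rewrite !modnMDl !modn_small.
split=> //; apply: val_inj; rewrite /= Ea in E *.
by move/eqP: E; rewrite eqn_add2r eqn_pmul2r // => /eqP.
Qed.

Variable G : graph_pair m.

Lemma measured_edge (i j : 'I_m) (a b : 'I_r) : (i, j) \in edges1 G ->
  (block_idx i a, block_idx j b) \in induced_measurements G.
Proof.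
move=> ij; rewrite inE; apply/or3P/Or33.
apply/existsP; exists i; apply/existsP; exists j.
by apply/existsP; exists a; apply/existsP; exists b; rewrite eqxx ij.
Qed.

Lemma measured_tail (k l : 'I_n) :
  (m * r <= l)%N -> (k, l) \in induced_measurements G.
Proof. by move=> H; rewrite inE /= H orbT. Qed.

(** The corner is a diagonal entry of its block, which blocks of the second graph hide, so one query
    recognizes an edge of the first graph. *)
Lemma observed_corner (i j : 'I_m) : (0 < r)%N ->
  observed (induced_measurements G) (i * r) (j * r) = ((i, j) \in edges1 G).
Proof.
move=> r0; apply/existsP/idP => [[[k l]] | ij].
  rewrite inE /= => /and3P[+ /eqP Ek /eqP El].
  have kl (h : 'I_m) : (m * r <= h * r)%N = false.
    by rewrite leq_pmul2r // leqNgt ltn_ord.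
  rewrite -Ek -El !kl /= => /existsP[i' /existsP[j' /existsP[a /existsP[b]]]].
  move=> /andP[/eqP[Hk Hl]] Hab.
  have [] := @block_idx_inj i i' (Ordinal r0) a; first by rewrite addn0 Ek Hk.
  have [] := @block_idx_inj j j' (Ordinal r0) b; first by rewrite addn0 El Hl.
  move=> -> Hb -> Ha; case/orP: Hab => //= /andP[_].
  by rewrite -Ha -Hb eqxx.
exists (block_idx i (Ordinal r0), block_idx j (Ordinal r0)).
by rewrite measured_edge //= !addn0 !eqxx.
Qed.

End Blocks.

(** * Normalized factors and uniqueness of the completion *)

Section Gauge.
Variables (R : realType) (n r : nat).
Local Notation m := (n %/ r)%N.
Implicit Types (M : 'M[R]_n) (T : bool -> 'M[R]_(n, r)).

(* A factorization [M = U V^T] is determined up to [(U, V) -> (U Q, V Q^-T)];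
   the second condition fixes [Q]. *)
Definition normalized_factors M (i0 : 'I_m) T : Prop :=
  T false *m (T true)^T = M /\ row_block (T false) i0 = 1%:M.

(** The row block of U at [i0] is a left factor of an invertible block, hence invertible, and can be
    moved into V. One block of row [i0] suffices, so a measured edge makes this apply to an unknown
    solution. *)
Lemma normalized_factors_exist M (i0 j : 'I_m) :
  (\rank M <= r)%N -> \rank (block M i0 j) = r ->
  exists T, normalized_factors M i0 T.
Proof.
move=> /rank_factor[U [V ->]]; rewrite block_mul_tr => rkB.
have uU : row_block U i0 \in unitmx.
  rewrite -row_free_unit -row_leq_rank -{1}rkB; exact: mxrankM_maxl.
exists (fun p => if p then V *m (row_block U i0)^T
                 else U *m invmx (row_block U i0)).
split; first by rewrite trmx_mul trmxK mulmxA mulmxKV.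
rewrite -(mulmxV uU); apply/matrixP => a b; rewrite !mxE.
by apply: eq_bigr => c _; rewrite !mxE.
Qed.

Lemma normalized_factors_mul M i0 T p : M^T = M ->
  normalized_factors M i0 T -> T p *m (T (~~ p))^T = M.
Proof.
move=> symM [TM _]; case: p => //=.
by rewrite -[LHS]trmxK trmx_mul trmxK TM.
Qed.

Lemma normalized_factors_unit M i0 T p (i : 'I_m) : M^T = M ->
  normalized_factors M i0 T -> \rank (block M i i) = r ->
  row_block (T p) i \in unitmx.
Proof.
move=> symM NT; rewrite -(normalized_factors_mul p symM NT) block_mul_tr => rkB.
rewrite -row_free_unit -row_leq_rank -{1}rkB; exact: mxrankM_maxl.
Qed.

Lemma low_complexity_unique (G : graph_pair m) M Omega :
  (0 < r)%N -> (0 < m)%N -> low_complexity G M Omega ->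
  unique (solution M Omega r) M.
Proof.
move=> r0 m0 [[psdM rkM] rkB -> conG nbG].
split; first by split=> //; rewrite rkM.
move=> M' [rkM' psdM' eqM].
have symM := psdM.1; have symM' := psdM'.1.
have eqO k l : (k, l) \in induced_measurements G -> M' k l = M k l.
  by move=> kl; move/matrixP/(_ k l): eqM; rewrite !mxE kl.
have eqB i j : (i, j) \in edges1 G -> block M' i j = block M i j.
  by move=> ij; apply/matrixP => a b; rewrite !mxE eqO // measured_edge.
pose i0 := Ordinal m0.
(* Without an edge at [i0], the single node (i0, false) would be closed under steps and thus be the
   whole double cover. The edge provides a block of [M'] known to be invertible. *)
have [j ij] : exists j, (i0, j) \in edges1 G.
  apply/existsP; apply: contraT => /existsPn no_edge.
  have := double_cover_ind (S := pred1 (i0, false)) (edges1_sym G) conG nbG (eqxx _).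
  move=> H; have /H/(_ (i0, true)) : forall i j q, pred1 (i0, false) (i, q) ->
      (i, j) \in edges1 G -> pred1 (i0, false) (j, ~~ q).
    by move=> i j q /eqP[-> _]; rewrite (negbTE (no_edge j)).
  by rewrite /= xpair_eqE andbF.
have [T NT] : exists T, normalized_factors M i0 T.
  by apply: (@normalized_factors_exist _ _ i0); rewrite ?rkM.
have [T' NT'] : exists T, normalized_factors M' i0 T.
  by apply: (@normalized_factors_exist _ _ j); rewrite ?eqB.
have unitT p i := normalized_factors_unit p symM NT (rkB i i).
have TT' : forall x : 'I_m * bool, row_block (T x.2) x.1 = row_block (T' x.2) x.1.
  move=> x; apply/eqP; move: x.
  apply: (double_cover_ind (S := fun x => row_block (T x.2) x.1 == row_block (T' x.2) x.1)
            (edges1_sym G) conG nbG (i0 := i0)).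
    by rewrite /= NT.2 NT'.2.
  (* Both row blocks at [h] solve the same system, with the invertible coefficient block at [i]. *)
  move=> i h q /= /eqP E ih; apply/eqP/trmx_inj; apply: (can_inj (mulKmx (unitT q i))).
  rewrite -block_mul_tr [in RHS]E -block_mul_tr.
  by rewrite (normalized_factors_mul q symM NT) (normalized_factors_mul q symM' NT') eqB.
suff ET q : T q = T' q by rewrite -NT.1 -NT'.1 !ET.
apply/row_matrixP => k.
have [h a ->|km] := @indexP n r k.
  have /matrixP Eh := TT' (h, q).
  by apply/rowP => c; have := Eh a c; rewrite !mxE.
(* A trailing row is handled like a block, through its fully measured column against the rows of
   block [i0]. *)
apply/trmx_inj; apply: (can_inj (mulKmx (unitT (~~ q) i0))).
have Erow S S' : row_block S i0 *m (row k S')^T = \col_a ((S *m S'^T) (block_idx i0 a) k).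
  by apply/colP => a; rewrite !mxE; apply: eq_bigr => c _; rewrite !mxE.
rewrite Erow [in RHS](TT' (i0, ~~ q)) Erow.
rewrite -{2 4}(negbK q) (normalized_factors_mul _ symM NT) (normalized_factors_mul _ symM' NT').
by apply/colP => a; rewrite !mxE eqO // measured_tail.
Qed.

End Gauge.

(** * Solving the linear systems *)

(** Conventions: [iN], [iR], [iZero], [iOne] hold n, r, 0, 1; [iEnd] holds m r; [iHead] and [iTail]
    delimit the queue; [iSrc] is the first row of the coefficient block, [iPar] its side and [iOpp]
    the other side; unknown rows range from [iLo] to [iHi], exclusive. Real arrays 0 and 1 hold T_0
    and T_1. *)
Local Notation iN := 0%N (only parsing).
Local Notation iR := 1%N (only parsing).
Local Notation iZero := 2%N (only parsing).
Local Notation iOne := 3%N (only parsing).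
Local Notation iEnd := 4%N (only parsing).
Local Notation iHead := 5%N (only parsing).
Local Notation iTail := 6%N (only parsing).
Local Notation iSrc := 7%N (only parsing).
Local Notation iPar := 8%N (only parsing).
Local Notation iOpp := 9%N (only parsing).
Local Notation iLo := 10%N (only parsing).
Local Notation iHi := 11%N (only parsing).
Local Notation iK := 12%N (only parsing).
Local Notation iRow := 13%N (only parsing).
Local Notation iA := 14%N (only parsing).
Local Notation iC := 15%N (only parsing).
Local Notation iTmp := 16%N (only parsing).

Local Notation xE := 1%N (only parsing).
Local Notation xU := 2%N (only parsing).
Local Notation xV := 3%N (only parsing).
Local Notation xD := 4%N (only parsing).

Local Notation aH := 2%N (only parsing).
Local Notation aS := 3%N (only parsing).

Local Notation "p ;; q" := (Seq p q) (at level 90, right associativity).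

(** Subtracting makes one routine serve twice: from 0 it yields an entry of s, from a right-hand
    side it yields the residual. *)
Definition Dot (p arr : nat) : program :=
  For iC iZero iR
    (Do (RLoad xU p iRow iC) ;; Do (RLoad xV arr iA iC) ;;
     Do (ROp RMul xU xU xV) ;; Do (ROp RSub xE xE xU)).

Definition Axpy (arr : nat) : program :=
  For iC iZero iR
    (Do (RLoad xU aS iZero iC) ;; Do (ROp RMul xU xE xU) ;;
     Do (RLoad xV arr iA iC) ;; Do (ROp RAdd xV xV xU) ;;
     Do (RStore arr iA iC xV)).

(* Array [aH] holds the projection H; [Direction] stores s = - H a_k in array [aS]
   and a_k . s in register [xD], where a_k is the row [iRow] of array [p]. As the
   sign cancels, the updates of H and of x both add a multiple of s / (a_k . s).
   The unknown rows x keep whatever value they have at the start: the final value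
   does not depend on it, since the system has only one solution. *)
Definition InitH : program :=
  For iA iZero iR
    (Do (RConst xU 0) ;;
     For iC iZero iR (Do (RStore aH iA iC xU)) ;;
     Do (RConst xU 1) ;; Do (RStore aH iA iA xU)).

Definition Direction (p : bool) : program :=
  Do (RConst xD 0) ;;
  For iA iZero iR
    (Do (RConst xE 0) ;; Dot p aH ;; Do (RStore aS iZero iA xE) ;;
     Do (RLoad xU p iRow iA) ;; Do (ROp RMul xU xU xE) ;;
     Do (ROp RAdd xD xD xU)).

Definition UpdateH : program :=
  For iA iZero iR
    (Do (RLoad xE aS iZero iA) ;; Do (ROp RDiv xE xE xD) ;; Axpy aH).

Definition UpdateX (p : bool) : program :=
  For iA iLo iHi
    (Do (RInput xE iRow iA) ;; Dot p (~~ p) ;;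
     Do (ROp RDiv xE xE xD) ;; Axpy (~~ p)).

(** Array [p] supplies the coefficients and array [~~ p] receives the unknown rows. All unknown rows
    share one projection, so up to r of them cost O(r^3) together. *)
Definition Solve (p : bool) : program :=
  InitH ;;
  For iK iZero iR
    (Do (IAdd iRow iSrc iK) ;; Direction p ;; UpdateH ;; UpdateX p).

Local Ltac is_numeral t :=
  lazymatch t with
  | O => idtac
  | S ?u => is_numeral u
  | addn ?u ?v => is_numeral u; is_numeral v
  end.

Local Ltac abstract_term t := let z := fresh "z" in set (z := t) in *; clearbody z.

Local Ltac abstract_product a b :=
  tryif (first [is_numeral a | is_numeral b]) then fail else abstract_term (muln a b).

(* [lia] alone is very slow in contexts with products of variables. *)
Local Ltac budget :=
  repeat match goal with
  | _ : context [expn ?a ?b] |- _ => abstract_term (expn a b)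
  | |- context [expn ?a ?b] => abstract_term (expn a b)
  | _ : context [muln ?a ?b] |- _ => abstract_product a b
  | |- context [muln ?a ?b] => abstract_product a b
  end; lia.

Local Ltac wp_instr := apply: wp_do; [first [budget | lia]|].
Local Ltac wp_step := apply: wp_seq; wp_instr.

(** * Effect and cost of the elementary loops *)

Section Solve.
Variables (R : realType) (n : nat) (Omega : {set 'I_n * 'I_n}) (A : 'M[R]_n).
Notation wp := (@wp R n Omega A).
Implicit Types (s : state R) (Q : state R -> nat -> Prop).

Lemma upd_arrE (T : Type) (f : nat -> nat -> nat -> T) arr i j v arr' i' j' :
  upd_arr f arr i j v arr' i' j' =
  if [&& arr' == arr, i' == i & j' == j] then v else f arr' i' j'.
Proof.
rewrite /upd_arr /upd; case: eqP => [->|//]; case: eqP => [->|//].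
by case: eqP.
Qed.

(** Here and in the following bounds each [For] loop is charged its body plus 2 per iteration, and 2
    once; this body has four instructions. *)
Lemma wp_dot (p arr : nat) s k Q (r := ireg s iR) :
  ireg s iZero = 0%N -> ireg s iOne = 1%N -> (r * 6 + 2 <= k)%N ->
  (forall s' k', frame (Dot p arr) s s' -> (k <= k' + (r * 6 + 2))%N ->
     rreg s' xE = rreg s xE
       - \sum_(c < r) rarr s p (ireg s iRow) c * rarr s arr (ireg s iA) c ->
     Q s' k') ->
  wp (Dot p arr) s k Q.
Proof.
move=> s2 s3 lek HQ.
apply: (@wp_for _ _ _ _ _ _ _ _ 4 _ _ (fun v rr _ => rr xE = rreg s xE
   - \sum_(c < v) rarr s p (ireg s iRow) c * rarr s arr (ireg s iA) c)) => //.
- by rewrite s2.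
- by rewrite s2 big_ord0 subr0.
- by rewrite s2 subn0.
- move=> v s' k' F Ev Hv Hx lek'.
  do 3!wp_step; wp_instr => /=.
  split; first by lia.
  rewrite /upd /= Ev Hx big_ord_recr /= opprD addrA.
  by rewrite !(frame_rarr F) // !(frame_ireg F).
- by move=> s' k' F Hx; rewrite s2 subn0 => Hk; apply: HQ.
Qed.

Lemma wp_axpy (arr : nat) s k Q (r := ireg s iR) : arr != aS ->
  ireg s iZero = 0%N -> ireg s iOne = 1%N -> (r * 7 + 2 <= k)%N ->
  (forall s' k', frame (Axpy arr) s s' -> (k <= k' + (r * 7 + 2))%N ->
     (forall i j, rarr s' arr i j = rarr s arr i j
       + (if (i == ireg s iA) && (j < r)%N then rreg s xE * rarr s aS 0 j else 0)) ->
     Q s' k') ->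
  wp (Axpy arr) s k Q.
Proof.
move=> arr3 s2 s3 lek HQ.
apply: (@wp_for _ _ _ _ _ _ _ _ 5 _ _ (fun v _ ra => forall i j,
   ra arr i j = rarr s arr i j
       + (if (i == ireg s iA) && (j < v)%N then rreg s xE * rarr s aS 0 j else 0))) => //.
- by rewrite s2.
- by move=> i j; rewrite s2 andbF addr0.
- by rewrite s2 subn0.
- move=> v s' k' F Ev Hv Hx lek'.
  do 4!wp_step; wp_instr => /=.
  split; first by lia.
  move=> i j; rewrite upd_arrE /upd /= eqxx Ev /=.
  have -> : ireg s' 14 = ireg s 14 by rewrite (frame_ireg F).
  have -> : ireg s' 2 = 0%N by rewrite (frame_ireg F).
  have -> : rarr s' 3 = rarr s 3.
    by rewrite (frame_rarr F) //= eq_sym (negbTE arr3).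
  rewrite (frame_rreg F) // !Hx.
  case: eqP => [->|//]; rewrite eqxx /= (ltnS j) (leq_eqVlt j).
  by case: eqVneq => [->|//] /=; rewrite ltnn addr0.
- by move=> s' k' F Hx; rewrite s2 subn0 => Hk; apply: HQ.
Qed.

Lemma wp_initH s k Q (r := ireg s iR) :
  ireg s iZero = 0%N -> ireg s iOne = 1%N -> (r * (r * 3 + 7) + 2 <= k)%N ->
  (forall s' k', frame InitH s s' -> (k <= k' + (r * (r * 3 + 7) + 2))%N ->
     (forall a c, (a < r)%N -> (c < r)%N -> rarr s' aH a c = (a == c)%:R) ->
     Q s' k') ->
  wp InitH s k Q.
Proof.
move=> s2 s3 lek HQ.
apply: (@wp_for _ _ _ _ _ _ _ _ (r * 3 + 5) _ _ (fun v _ ra =>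
   forall a c, (a < v)%N -> (c < r)%N -> ra aH a c = (a == c)%:R)) => //.
- by rewrite s2.
- by move=> a c; rewrite s2.
- by rewrite s2 subn0 -/r -addnA.
- move=> v s1 k1 F Ev Hv Hx lek1.
  have [s12 s13 s1r] : [/\ ireg s1 iZero = 0%N, ireg s1 iOne = 1%N & ireg s1 iR = r].
    by rewrite !(frame_ireg F).
  wp_step; apply: wp_seq => /=.
  apply: (@wp_for _ _ _ _ _ _ _ _ 1 _ _ (fun v' rr ra => rr xU = 0 /\ forall a c,
    ra aH a c = if (a == v) && (c < v')%N then 0 else rarr s1 aH a c)) => //=.
  + by rewrite s12.
  + by rewrite /upd /= s12; split=> // a c; rewrite andbF.
  + by rewrite s12 s1r; lia.
  + move=> c s2' k2 F2 Ec Hc [Hu H2] lek2; wp_instr => /=.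
    split; first by lia.
    split=> // a c'; rewrite upd_arrE /= Ec Hu (frame_ireg F2) //= Ev H2.
    by case: (a == v); rewrite //= (ltnS c') (leq_eqVlt c' c); case: eqP.
  rewrite s12 s1r subn0 => s2' k2 F2 [Hu H2] lek2.
  wp_step; wp_instr => /=.
  split; first by lia.
  move=> a c Ha Hc; rewrite upd_arrE /upd /= !(frame_ireg F2) //= Ev H2 Hc andbT.
  have [Eav|Nav] /= := eqVneq a v.
    by rewrite Eav [v == c]eq_sym; case: eqP.
  by rewrite Hx //; lia.
- by move=> s' k' F Hx; rewrite s2 subn0 -/r -addnA => Hk; apply: HQ.
Qed.

Section Update.
Variables (p : bool) (s : state R).
Let r := ireg s iR.
Let w c := rarr s p (ireg s iRow) c.
Let sv a := - \sum_(c < r) w c * rarr s aH a c.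

Lemma wp_direction k Q :
  ireg s iZero = 0%N -> ireg s iOne = 1%N -> (r * (r * 6 + 9) + 3 <= k)%N ->
  (forall s' k', frame (Direction p) s s' -> (k <= k' + (r * (r * 6 + 9) + 3))%N ->
     (forall a, (a < r)%N -> rarr s' aS 0 a = sv a) ->
     rreg s' xD = \sum_(a < r) w a * sv a -> Q s' k') ->
  wp (Direction p) s k Q.
Proof.
move=> s2 s3 lek HQ; apply: wp_frame; wp_step.
set s0 := eval_step _ _ _.
apply: (@wp_for _ _ _ _ _ _ _ _ (r * 6 + 7) _ _ (fun v rr ra =>
   (forall a, (a < v)%N -> ra aS 0 a = sv a) /\
   rr xD = \sum_(a < v) w a * sv a)) => //=.
- by rewrite s2.
- by rewrite s2 big_ord0.
- by rewrite s2 subn0 -/r; lia.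
- move=> v s1 k1 F Ev; rewrite s2 -/r => Hv [Hs Hd] lek1.
  wp_step; apply: wp_seq; apply: wp_dot => /=.
  + by rewrite (frame_ireg F).
  + by rewrite (frame_ireg F).
  + by rewrite (frame_ireg F) // -/r; lia.
  rewrite Ev !(frame_ireg F) // -/r => s2' k2 F2 lek2 He.
  have {}He : rreg s2' xE = sv v.
    rewrite He /upd /= add0r /sv (frame_rarr F (x := p)) ?(frame_rarr F) //; last by case: (p).
  do 3!wp_step; wp_instr => /=; split; first by lia.
  split=> [a Ha|].
    rewrite upd_arrE /= !(frame_ireg F2) //= (frame_ireg F) //= s2 Ev He eqxx /=.
    case: eqP => [->//|Na]; rewrite (frame_rarr F2) // Hs //; lia.
  rewrite /upd /= upd_arrE /= big_ord_recr /=.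
  rewrite (_ : (p : nat) == 3 = false) ?He; last by case: (p).
  rewrite (frame_rreg F2) // /upd /= Hd !(frame_ireg F2) //= Ev (frame_rarr F2) /=; last by case: (p).
  by rewrite (frame_rarr F) ?(frame_ireg F) //; case: (p).
- move=> s' k' F' [Hs Hd] Hk F; rewrite s2 subn0 -/r in Hk.
  by apply: HQ => //; lia.
Qed.

Lemma wp_updateH (t : nat -> R) d k Q :
  ireg s iZero = 0%N -> ireg s iOne = 1%N -> (r * (r * 7 + 6) + 2 <= k)%N ->
  (forall a, (a < r)%N -> rarr s aS 0 a = t a) -> rreg s xD = d ->
  (forall s' k', frame UpdateH s s' -> (k <= k' + (r * (r * 7 + 6) + 2))%N ->
     (forall a c, (a < r)%N -> (c < r)%N ->
        rarr s' aH a c = rarr s aH a c + t a / d * t c) -> Q s' k') ->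
  wp UpdateH s k Q.
Proof.
move=> s2 s3 lek Ht Hd HQ.
apply: (@wp_for _ _ _ _ _ _ _ _ (r * 7 + 4) _ _ (fun v _ ra => forall a c,
   (c < r)%N ->
   ra aH a c = rarr s aH a c + if (a < v)%N then t a / d * t c else 0)) => //=.
- by rewrite s2.
- by move=> a c _; rewrite s2 addr0.
- by rewrite s2 subn0 -/r; lia.
- move=> v s1 k1 F Ev; rewrite s2 -/r => Hv HH lek1.
  do 2!wp_step; apply: wp_axpy => //=.
  + by rewrite (frame_ireg F).
  + by rewrite (frame_ireg F).
  + by rewrite (frame_ireg F) // -/r; lia.
  rewrite (frame_ireg F (x := iR)) // -/r => s2' k2 F2 lek2 H2; split; first by lia.
  move=> a c Hc; rewrite H2 /upd /= Ev HH // !(frame_ireg F) // s2 Hc andbT.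
  rewrite (frame_rarr F (x := aS)) // !Ht // ?(frame_rreg F) // Hd.
  rewrite (ltnS a) (leq_eqVlt a v); case: eqVneq => [->|_] /=; last by rewrite addr0.
  by rewrite ltnn addr0.
- move=> s' k' F HH Hk; rewrite s2 subn0 -/r in Hk; apply: HQ => //; first by lia.
  by move=> a c Ha Hc; rewrite HH // Ha.
Qed.

Lemma wp_updateX (t : nat -> R) d k Q (lo := ireg s iLo) (hi := ireg s iHi) :
  ireg s iZero = 0%N -> ireg s iOne = 1%N -> (lo <= hi)%N ->
  ((hi - lo) * (r * 13 + 8) + 2 <= k)%N ->
  (forall a, (a < r)%N -> rarr s aS 0 a = t a) -> rreg s xD = d ->
  (forall s' k', frame (UpdateX p) s s' ->
     (k <= k' + ((hi - lo) * (r * 13 + 8) + 2))%N ->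
     (forall b c, (c < r)%N -> rarr s' (~~ p) b c = rarr s (~~ p) b c
        + if (lo <= b < hi)%N
          then (entry A (ireg s iRow) b
                - \sum_(c < r) w c * rarr s (~~ p) b c) / d * t c else 0) ->
     (forall b c, ~~ (lo <= b < hi)%N -> rarr s' (~~ p) b c = rarr s (~~ p) b c) ->
      Q s' k') ->
  wp (UpdateX p) s k Q.
Proof.
move=> s2 s3 lelh lek Ht Hd HQ.
apply: (@wp_for _ _ _ _ _ _ _ _ (r * 13 + 6) _ _ (fun v _ ra =>
   forall b c, ra (~~ p : nat) b c = rarr s (~~ p) b c
        + if (lo <= b < v)%N && (c < r)%N
          then (entry A (ireg s iRow) b
                - \sum_(c < r) w c * rarr s (~~ p) b c) / d * t c else 0)) => //=.
- by move=> b c; case: ifP; rewrite ?addr0 // -/lo; lia.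
- by rewrite -/hi -/lo; lia.
- rewrite -/hi -/lo => v s1 k1 F Ev Hv HX lek1.
  wp_step; apply: wp_seq; apply: wp_dot => /=.
  + by rewrite (frame_ireg F) //; case: (p).
  + by rewrite (frame_ireg F) //; case: (p).
  + by rewrite (frame_ireg F) // -/r; lia.
  rewrite Ev !(frame_ireg F) // -/r => s2' k2 F2 lek2 He.
  (* Row [v] lies outside the part updated so far, so its residual may be written with the initial
     values. *)
  have {}He : rreg s2' xE = entry A (ireg s iRow) v
      - \sum_(c < r) w c * rarr s (~~ p) v c.
    rewrite He /upd /=; congr (_ - _); apply: eq_bigr => c _.
    rewrite HX ltnn andbF addr0 (frame_rarr F) //.
    by case: (p).
  wp_step; apply: wp_axpy => /=.
  + by case: (p).
  + by rewrite (frame_ireg F2) //= (frame_ireg F).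
  + by rewrite (frame_ireg F2) //= (frame_ireg F).
  + by rewrite (frame_ireg F2) //= (frame_ireg F) // -/r; lia.
  rewrite (frame_ireg F2) //= (frame_ireg F) // -/r => s3' k3 F3 lek3 H3.
  split; first by lia.
  move=> b c; rewrite H3 /upd /= !(frame_rarr F2) //= He HX.
  rewrite (frame_ireg F2) //= Ev (frame_rreg F2) //= /upd /= (frame_rreg F) // Hd.
  rewrite ltnS (leq_eqVlt b v).
  have [->|Nbv] /= := eqVneq b v; last by rewrite addr0.
  rewrite ltnn andbF /= addr0 andbT; have -> : (lo <= v)%N by lia.
  case: ifP => //= Hc; rewrite (frame_rarr F) // ?Ht //.
  by case: (p).
- move=> s' k' F HX Hk; rewrite -/hi -/lo in Hk; apply: HQ => //; first by lia.
    by move=> b c Hc; rewrite HX Hc andbT.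
  by move=> b c /negbTE Hb; rewrite HX Hb addr0.
Qed.

End Update.

End Solve.

(** * Correctness and cost of the complete solver *)

Section WpSolve.
Variables (R : realType) (n : nat) (Omega : {set 'I_n * 'I_n}) (A : 'M[R]_n).
Notation wp := (@wp R n Omega A).

Definition mx_of (r : nat) (f : nat -> nat -> R) : 'M[R]_r := \matrix_(i, j) f i j.

(** The outcome is left as the equations themselves; [wp_solve_factor] cancels the invertible block
    to read off values. The interval may be shorter than r or empty, as for the trailing rows. *)
Lemma wp_solve (p : bool) (s : state R) k (Q : state R -> nat -> Prop)
    (r := ireg s iR) (i := ireg s iSrc) (lo := ireg s iLo) (hi := ireg s iHi) :
  ireg s iZero = 0%N -> ireg s iOne = 1%N -> (0 < r)%N -> (lo <= hi <= lo + r)%N ->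
  (73 * r ^ 3 <= k)%N ->
  mx_of r (fun a => rarr s p (i + a)) \in unitmx ->
  (forall s' k', frame (Solve p) s s' -> (k <= k' + 73 * r ^ 3)%N ->
     (forall b a, (lo <= b < hi)%N -> (a < r)%N ->
        \sum_(c < r) rarr s p (i + a) c * rarr s' (~~ p) b c = entry A (i + a) b) ->
     (forall b c, ~~ (lo <= b < hi)%N -> rarr s' (~~ p) b c = rarr s (~~ p) b c) ->
     Q s' k') ->
  wp (Solve p) s k Q.
Proof.
set B := mx_of _ _ => s2 s3 r0 lohi lek uB HQ; apply: wp_frame; apply: wp_seq.
(* The left side expands to 26 r^3 + 26 r^2 + 17 r + 4, and 26 + 26 + 17 + 4 = 73 with r at least
   1. *)
have cost : (r * (r * 3 + 7) + 2 + (r * (r * (r * 26 + 23) + 8 + 2) + 2) <= 73 * r ^ 3)%N.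
  rewrite !expnS expn0; have := r0; move: (r) => [//|r' _]; nia.
apply: wp_initH => //; first by rewrite -/r; lia.
rewrite -/r => s0 k0 F0 lek0 H0.
have [s02 s03 s0r] : [/\ ireg s0 iZero = 0%N, ireg s0 iOne = 1%N & ireg s0 iR = r].
  by rewrite !(frame_ireg F0).
apply: (@wp_for _ _ _ _ _ _ _ _ (r * (r * 26 + 23) + 8) _ _ (fun v _ ra =>
  [/\ is_projector B v (mx_of r (ra aH)),
   forall b a, (lo <= b < hi)%N -> (a < v)%N ->
        \sum_(c < r) rarr s p (i + a) c * ra (~~ p : nat) b c = entry A (i + a) b
  & forall b c, ~~ (lo <= b < hi)%N -> ra (~~ p : nat) b c = rarr s (~~ p) b c])) => //.
- by rewrite s02.
- rewrite s02; split=> // [|b c _]; last by rewrite (frame_rarr F0) //; case: (p).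
  rewrite (_ : mx_of _ _ = 1%:M); first exact: is_projector0.
  by apply/matrixP => a c; rewrite !mxE H0.
- by rewrite s02 s0r subn0; lia.
- move=> v s1 k1 F1 Ev; rewrite s02 s0r => /= Hv [PH HX HN] lek1.
  have I1 y : ~~ writes (Solve p) IReg y -> ireg s1 y = ireg s y.
    move=> Hy; rewrite (frame_ireg F1) ?(frame_ireg F0) //.
      by apply: contra Hy => /= ->.
    by apply: contra Hy => /= ->; rewrite orbT.
  wp_step; set s1' := eval_step _ _ _.
  have I1' y : ~~ writes (Solve p) IReg y -> ireg s1' y = ireg s y.
    move=> Hy; rewrite -I1 // /s1' /= /upd; case: eqP => // Ey.
    by move: Hy; rewrite Ey.
  have Erow : ireg s1' iRow = (i + v)%N by rewrite /s1' /= /upd /= Ev I1.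
  have EW a c : rarr s1' p a c = rarr s p a c.
    by rewrite (frame_rarr F1) ?(frame_rarr F0) //; case: (p).
  have lek1' : (r * (r * 26 + 23) + 7 <= k1.-1)%N by lia.
  apply: wp_seq; apply: wp_direction.
  + by rewrite I1'.
  + by rewrite I1'.
  + by rewrite I1' // -/r; nia.
  rewrite I1' // -/r Erow.
  set t := fun a : nat => - \sum_(c < r) rarr s1' p (i + v) c * rarr s1' aH a c.
  set d := \sum_(a < r) _.
  move=> sa ka Fa leka Ha Hd.
  have Ia y : ~~ writes (Solve p) IReg y -> ireg sa y = ireg s y.
    move=> Hy; rewrite (frame_ireg Fa) ?I1' //.
    by apply: contra Hy => /= ->; rewrite !orbT.
  apply: wp_seq; apply: (@wp_updateH _ _ _ _ sa t d).
  + by rewrite Ia.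
  + by rewrite Ia.
  + by rewrite Ia // -/r; nia.
  + by rewrite Ia.
  + by [].
  rewrite Ia // -/r => sb kb Fb lekb Hb.
  have Ib y : ~~ writes (Solve p) IReg y -> ireg sb y = ireg s y.
    move=> Hy; rewrite (frame_ireg Fb) ?Ia //.
    by apply: contra Hy => /= ->; rewrite !orbT.
  apply: (@wp_updateX _ _ _ _ p sb t d).
  + by rewrite Ib.
  + by rewrite Ib.
  + by rewrite !Ib // -/lo -/hi; lia.
  + rewrite !Ib // -/lo -/hi -/r; have : (hi - lo <= r)%N by lia.
    move: (hi - lo)%N => e le_er; nia.
  + by move=> a; rewrite Ib // (frame_rarr Fb) //; apply: Ha.
  + by rewrite (frame_rreg Fb).
  have Eb : ireg sb iRow = (i + v)%N by rewrite (frame_ireg Fb) // (frame_ireg Fa).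
  rewrite Eb !Ib // -/lo -/hi -/r => sc kc Fc lekc Hc HNc.
  have EWb a c : rarr sb p a c = rarr s p a c.
    rewrite (frame_rarr Fb) ?(frame_rarr Fa) ?EW //; by case: (p).
  have EXb a c : rarr sb (~~ p) a c = rarr s1 (~~ p) a c.
    rewrite (frame_rarr Fb) ?(frame_rarr Fa) //; by case: (p).
  split.
    have : (hi - lo <= r)%N by lia.
    move: (hi - lo)%N lekc => e lekc le_er; nia.
  pose kO := Ordinal Hv.
  have := @projector_step _ _ B (mx_of r (rarr s1 aH)) kO uB PH.
  (* The program multiplies by rows of H, giving H b^T; symmetry of H identifies this with bH. *)
  have tE : - (row kO B *m mx_of r (rarr s1 aH)) = \row_a t a.
    case: PH => symH _ _ _; apply/rowP => a; rewrite !mxE /t; congr (- _).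
    apply: eq_bigr => c _; rewrite !mxE EW; congr (_ * _).
    by move/matrixP: symH => /(_ a c); rewrite !mxE.
  have dotE (j : 'I_r) : (row j B *m (\row_a t a)^T) 0 0 = \sum_(c < r) rarr s p (i + j) c * t c.
    by rewrite mxE; apply: eq_bigr => c _; rewrite !mxE.
  rewrite tE dotE.
  have <- : d = \sum_(c < r) rarr s p (i + kO) c * t c.
    by apply: eq_bigr => c _; rewrite EW.
  move=> [d0 PH' Ht].
  split.
  + rewrite (_ : mx_of r _ = mx_of r (rarr s1 aH) + d^-1 *: ((\row_a t a)^T *m \row_a t a)) //.
    apply/matrixP => a c; rewrite !mxE big_ord1 !mxE (frame_rarr Fc); last by case: (p).
    rewrite Hb // (frame_rarr Fa) //; congr (_ + _).
    by rewrite mulrAC mulrC.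
  + move=> b a Hrange Hav.
    (* Equation [a] changes by a multiple of the dot product of its coefficient row with s: for [a]
       = [v] this is d and the residual is cancelled, for [a] < [v] it is zero. *)
    have -> : \sum_(c < r) rarr s p (i + a) c * rarr sc (~~ p) b c =
        \sum_(c < r) rarr s p (i + a) c * rarr s1 (~~ p) b c +
        (entry A (i + v) b - \sum_(c < r) rarr s p (i + v) c * rarr s1 (~~ p) b c) / d *
        \sum_(c < r) rarr s p (i + a) c * t c.
      rewrite mulr_sumr -big_split; apply: eq_bigr => c _.
      rewrite Hc // Hrange EXb mulrDr; congr (_ + _).
      rewrite mulrCA; congr ((_ - _) / _ * _).
      by apply: eq_bigr => c' _; rewrite EWb EXb.
    move: Hav; rewrite ltnS leq_eqVlt => /predU1P[->|Hav].
      have -> : \sum_(c < r) rarr s p (i + v) c * t c = d.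
        by apply: eq_bigr => c _; rewrite EW.
      by rewrite divfK // addrC subrK.
    have Har := ltn_trans Hav Hv.
    have := Ht (Ordinal Har) Hav; move/matrixP/(_ 0 0); rewrite dotE => ->.
    by rewrite mxE mulr0 addr0 HX.
  + by move=> b c Hrange; rewrite HNc // EXb HN.
- move=> s' k' F; rewrite s02 s0r subn0 => -[_ HX HN] lek' Fs.
  by apply: HQ => //; lia.
Qed.

End WpSolve.

(** * The search in the double cover *)
Local Notation aSeen := 0%N (only parsing).
Local Notation aQueue := 1%N (only parsing).

(** Integers have no multiplication, so m r is found by repeated addition, with [iTmp] one multiple
    ahead. Comparing with n + 1 makes the strict test accept a multiple equal to n. *)
Definition ComputeEnd : program :=
  Do (IAdd iTmp iR iZero) ;; Do (IAdd iHi iN iOne) ;;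
  While (TIntLt iTmp iHi)
    (Do (IAdd iEnd iTmp iZero) ;; Do (IAdd iTmp iTmp iR)).

(** The identity is the normalization of T_0. Zero-initialized memory already holds [iHead] = 0 and
    the queue entry for block 0 with side false. *)
Definition InitSearch : program :=
  Do (RConst xU 1) ;;
  For iA iZero iR (Do (RStore 0 iA iA xU)) ;;
  Do (IStore aSeen iZero iZero iOne) ;;
  Do (IAdd iTail iOne iZero).

(** Array names are fixed in the program text, hence the two copies of [Solve]. A node is stored as
    the first row of its block and its side, which avoids multiplications. *)
Definition Visit : program :=
  If (TIntLt iZero iPar) (Solve true) (Solve false) ;;
  Do (IStore aSeen iLo iOpp iOne) ;;
  Do (IStore aQueue iTail iZero iLo) ;;
  Do (IStore aQueue iTail iOne iOpp) ;;
  Do (IAdd iTail iTail iOne).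

Definition Scan : program :=
  While (TIntLt iLo iEnd)
    (Do (IAdd iHi iLo iR) ;;
     If (TObserved iSrc iLo)
       (Do (ILoad iTmp aSeen iLo iOpp) ;; If (TIntLt iTmp iOne) Visit Skip)
       Skip ;;
     Do (IAdd iLo iHi iZero)).

Definition Traverse : program :=
  While (TIntLt iHead iTail)
    (Do (ILoad iSrc aQueue iHead iZero) ;;
     Do (ILoad iPar aQueue iHead iOne) ;;
     Do (ISub iOpp iOne iPar) ;;
     Do (IConst iLo 0) ;;
     Scan ;;
     Do (IAdd iHead iHead iOne)).

(** Fewer than r rows remain, fully measured against block 0, so block 0 of each factor determines
    them in the other one. *)
Definition SolveTail : program :=
  Do (IConst iSrc 0) ;; Do (IAdd iLo iEnd iZero) ;; Do (IAdd iHi iN iZero) ;;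
  Solve false ;; Solve true.

Definition Main : program :=
  Do (IConst iOne 1) ;; ComputeEnd ;; InitSearch ;; Traverse ;; SolveTail.

Lemma same_block (r i j a : nat) :
  (i * r <= j * r + a -> j * r + a < i.+1 * r -> a < r -> j = i)%N.
Proof. by move=> H1 H2 H3; apply/eqP; nia. Qed.

(** The summands follow the phases of [Main]. Lower-order terms are absorbed through m <= m^2 and r
    <= r^3 <= m r^3. *)
Lemma main_cost (m r : nat) : (0 < m)%N -> (0 < r)%N ->
  (1 + (3 * m + 3) + (3 + (r * 3 + 2)) +
   (2 * m * (7 * m + 8) + 2 * m * (73 * r ^ 3 + 5) + 1) + (146 * r ^ 3 + 3)
   <= 400 * (m * m + m * r ^ 3))%N.
Proof.
move=> m0 r0; have : (r <= r ^ 3)%N by rewrite -{1}(expn1 r) leq_pexp2l.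
move: (r ^ 3)%N => c rc.
have mm : (m <= m * m)%N by rewrite leq_pmull.
have cm : (c <= m * c)%N by rewrite leq_pmull.
by nia.
Qed.

(** * Correctness and cost of the search, relative to fixed normalized factors *)

Section Main.
Variables (R : realType) (n r : nat).
Local Notation m := (n %/ r)%N.
Variables (G : graph_pair m) (M : 'M[R]_n) (i0 : 'I_m) (T : bool -> 'M[R]_(n, r)).
Local Notation Omega := (induced_measurements G).
Local Notation A := (Defs.mask Omega M).
Local Notation wp := (@wp R n Omega A).
Hypothesis r0 : (0 < r)%N.
Hypothesis i00 : i0 = 0%N :> nat.
Hypothesis symM : M^T = M.
Hypothesis rkM : forall i j : 'I_m, \rank (block M i j) = r.
Hypothesis NT : normalized_factors M i0 T.
Hypothesis conG : graph_connected (edges1 G).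
Hypothesis nbG : ~ bipartite (edges1 G).
Implicit Types (s : state R) (Q : state R -> nat -> Prop).

Lemma entryE (B : 'M[R]_n) (k l : 'I_n) : entry B k l = B k l.
Proof. by rewrite /entry !valK. Qed.

Definition rows_known s (j : 'I_m) (q : bool) : Prop :=
  forall a c : 'I_r, rarr s q (j * r + a) c = T q (block_idx j a) c.

(** The measured entries make row [l] of [T (~~ p)] satisfy the equations that [Solve] establishes,
    and invertibility of the row block of [T p] leaves no other solution. *)
Lemma wp_solve_factor (p : bool) (i : 'I_m) s k Q
    (lo := ireg s iLo) (hi := ireg s iHi) :
  ireg s iR = r -> ireg s iZero = 0%N -> ireg s iOne = 1%N ->
  ireg s iSrc = (i * r)%N ->
  (lo <= hi <= lo + r)%N -> (hi <= n)%N -> (73 * r ^ 3 <= k)%N ->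
  rows_known s i p ->
  (forall a (l : 'I_n), (lo <= l < hi)%N -> (block_idx i a, l) \in Omega) ->
  (forall s' k', frame (Solve p) s s' -> (k <= k' + 73 * r ^ 3)%N ->
     (forall (l : 'I_n) (c : 'I_r), (lo <= l < hi)%N -> rarr s' (~~ p) l c = T (~~ p) l c) ->
     (forall b c, ~~ (lo <= b < hi)%N -> rarr s' (~~ p) b c = rarr s (~~ p) b c) ->
     Q s' k') ->
  wp (Solve p) s k Q.
Proof.
move=> s1 s2 s3 s7 lohi hin lek known obs HQ.
have unitT := normalized_factors_unit p symM NT (rkM i i).
have EB : mx_of r (fun a => rarr s p (i * r + a)) = row_block (T p) i.
  by apply/matrixP => a c; rewrite !mxE known.
apply: wp_solve; rewrite ?s1 ?s7 //; first by rewrite EB.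
move=> s' k' F lek' Hin Hout; apply: HQ => // l c Hl.
have : (\row_c rarr s' (~~ p) l c)^T = (row l (T (~~ p)))^T.
  apply: (can_inj (mulKmx unitT)); apply/colP => a.
  transitivity (M (block_idx i a) l); last first.
    rewrite -{1}(normalized_factors_mul p symM NT) !mxE.
    by apply: eq_bigr => c' _; rewrite !mxE.
  have <- : entry A (i * r + a) l = M (block_idx i a) l.
    by have := entryE A (block_idx i a) l; rewrite [RHS]mxE obs.
  rewrite -Hin // mxE; apply: eq_bigr => c' _.
  by rewrite !mxE known.
by move/trmx_inj/rowP/(_ c); rewrite !mxE.
Qed.

(** [L] is a ghost list of all nodes ever enqueued, in queue order. Dequeued nodes stay in it, so it
    also describes the marked nodes, and the rows of all of them are known. *)
Record search_state s (L : seq ('I_m * bool)) : Prop := SearchState {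
  ss_n : ireg s iN = n;
  ss_r : ireg s iR = r;
  ss_0 : ireg s iZero = 0%N;
  ss_1 : ireg s iOne = 1%N;
  ss_end : ireg s iEnd = (m * r)%N;
  ss_tail : ireg s iTail = size L;
  ss_uniq : uniq L;
  ss_start : (i0, false) \in L;
  ss_queue : forall t, (t < size L)%N ->
    iarr s aQueue t 0 = ((nth (i0, false) L t).1 * r)%N /\
    iarr s aQueue t 1 = (nth (i0, false) L t).2;
  ss_seen : forall (j : 'I_m) (q : bool), iarr s aSeen (j * r)%N q = ((j, q) \in L);
  ss_known : forall j q, (j, q) \in L -> rows_known s j q }.

Lemma search_size s L : search_state s L -> (size L <= 2 * m)%N.
Proof.
move=> H; rewrite -(card_uniqP (ss_uniq H)); apply: leq_trans (max_card _) _.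
by rewrite card_prod card_ord card_bool mulnC.
Qed.

Definition scanned (L : seq ('I_m * bool)) (i : 'I_m) (p : bool) (v : nat) : Prop :=
  forall j : 'I_m, (j < v)%N -> (i, j) \in edges1 G -> (j, ~~ p) \in L.

(* Charged to the growth of the queue. *)
Definition visit_cost := (73 * r ^ 3 + 5)%N.

Lemma wp_visit s k L (i j : 'I_m) (p : bool) Q :
  search_state s L -> (i, p) \in L -> (j, ~~ p) \notin L -> (i, j) \in edges1 G ->
  ireg s iSrc = (i * r)%N -> ireg s iPar = p -> ireg s iOpp = ~~ p ->
  ireg s iLo = (j * r)%N -> ireg s iHi = (j.+1 * r)%N -> (visit_cost <= k)%N ->
  (forall s' k', frame Visit s s' -> search_state s' (rcons L (j, ~~ p)) ->
     (k <= k' + visit_cost)%N -> Q s' k') ->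
  wp Visit s k Q.
Proof.
move=> [sn sr s0 s1 se st uL L0 sq ss sk] Lip Njp ij s7 s8 s9 s10 s11.
rewrite /visit_cost => lek HQ.
apply: wp_frame; apply: wp_seq.
pose Q' := fun s' k' =>
   [/\ (k <= k' + (73 * r ^ 3 + 1))%N,
      forall (l : 'I_n) (c : 'I_r), (j * r <= l < j.+1 * r)%N ->
        rarr s' (~~ p) l c = T (~~ p) l c,
      forall b c, ~~ (j * r <= b < j.+1 * r)%N -> rarr s' (~~ p) b c = rarr s (~~ p) b c
    & rarr s' p = rarr s p].
have solve : wp (Solve p) s k.-1 Q'.
  apply: (@wp_solve_factor p i) => //; rewrite ?s10 ?s11.
  - by rewrite mulSn addnC leqnn leq_addr.
  - by apply: leq_trans (leq_divM n r); rewrite leq_mul2r ltn_ord orbT.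
  - by budget.
  - by apply: sk.
  - move=> a l Hl; have [j' b El|lm] := @indexP n r l.
      rewrite El in Hl *; apply: measured_edge; suff -> : j' = j by [].
      by apply: val_inj; case/andP: Hl => H1 H2; apply: same_block H1 H2 (ltn_ord b).
    have : (j.+1 * r <= m * r)%N by rewrite leq_mul2r ltn_ord orbT.
    by budget.
  move=> s' k' F lek' H1 H2; split=> //; first by budget.
  by rewrite (frame_rarr F) //; case: (p).
apply: (@wp_conseq _ _ _ _ _ _ _ Q').
  apply: wp_if; first by budget.
    by rewrite /= s0 s8; case: (p) solve.
  by rewrite /= s0 s8; case: (p) solve.
move=> sa ka Fa [leka Hin Hout Hp].
(* Both copies of [Solve] write the same integer registers, so the frame of the conditional reduces
   to that of one copy. *)
have Ea y : ~~ writes (Solve true) IReg y -> ireg sa y = ireg s y.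
  move=> Hy; apply: (frame_ireg Fa); apply: contra Hy => /=.
  by rewrite orbb.
have Ia y : iarr sa y = iarr s y by rewrite (frame_iarr Fa).
do 3!wp_step; wp_instr => Fv; apply: HQ => //; last by budget.
split; rewrite /= /upd /= ?Ea // ?st ?s1 ?size_rcons ?addn1 ?rcons_uniq ?Njp //.
- by rewrite mem_rcons inE L0 orbT.
- move=> t; rewrite ltnS leq_eqVlt => Ht.
  rewrite !upd_arrE /= Ia ?s0 ?s1 ?s10 ?s9 ?st nth_rcons.
  case: (eqVneq t (size L)) Ht => [->|_] /= Ht; first by rewrite ltnn.
  by rewrite Ht; apply: sq.
- move=> j' q; rewrite !upd_arrE /= Ia ?s1 ?s10 ?s9 mem_rcons inE xpair_eqE.
  have -> : ((q : nat) == (~~ p)) = (q == ~~ p) by case: (p) q => [] [].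
  rewrite eqn_pmul2r // -[(j' : nat) == j]/(j' == j).
  by case: andP => //=.
- move=> j' q; rewrite mem_rcons inE => /orP[/eqP[-> ->] | Hjq] a c /=.
    apply: (Hin (block_idx j a)); rewrite /= leq_addr /= mulSn addnC ltn_add2r.
    exact: ltn_ord.
  (* Older nodes keep their rows: array [p] is unchanged, and in the other array only block [j] is
     rewritten, whose node was not in [L]. *)
  have [Eq|Nq] := eqVneq q p; first by rewrite Eq Hp -Eq; apply: sk.
  have Eq : q = ~~ p by case: (q) (p) Nq => [] [].
  rewrite Eq in Hjq *; rewrite Hout; first exact: sk.
  apply/negP => /andP[H1 H2]; suff Ej : j' = j by rewrite -Ej Hjq in Njp.
  by apply: val_inj; apply: same_block H1 H2 (ltn_ord a).
Qed.

Lemma search_state_ext s s' L : search_state s L ->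
  all (fun y => ireg s' y == ireg s y) [:: iN; iR; iZero; iOne; iEnd; iTail] ->
  iarr s' = iarr s -> rarr s' = rarr s -> search_state s' L.
Proof.
move=> [sn sr s0 s1 se st uL L0 sq ss sk] /= /and5P[/eqP en /eqP er /eqP e0 /eqP e1].
move=> /and3P[/eqP ee /eqP et _] ea er'.
by split; rewrite ?en ?er ?e0 ?e1 ?ee ?et ?ea // => j q; rewrite /rows_known er'; apply: sk.
Qed.

(** The term with [visit_cost] is a potential: each visit lengthens the list and so pays for itself.
    Otherwise a block costs at most 7, and [K0] is reserved for what follows the scan. *)
Lemma wp_scan s k L (i : 'I_m) (p : bool) K0 Q :
  search_state s L -> (i, p) \in L ->
  ireg s iSrc = (i * r)%N -> ireg s iPar = p -> ireg s iOpp = ~~ p -> ireg s iLo = 0%N ->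
  (m * 7 + 1 + (2 * m - size L) * visit_cost + K0 <= k)%N ->
  (forall s' k' X, frame Scan s s' -> search_state s' (L ++ X) ->
     scanned (L ++ X) i p m ->
     ((2 * m - size (L ++ X)) * visit_cost + K0 <= k')%N -> Q s' k') ->
  wp Scan s k Q.
Proof.
move=> SS Lip s7 s8 s9 s10 lek HQ.
pose J s' k' := exists v X, [/\ (v <= m)%N /\ ireg s' iLo = (v * r)%N,
  search_state s' (L ++ X), scanned (L ++ X) i p v &
  ((m - v) * 7 + 1 + (2 * m - size (L ++ X)) * visit_cost + K0 <= k')%N].
apply: (@wp_while _ _ _ _ _ _ _ _ _ J).
- by exists 0%N, [::]; rewrite cats0 subn0; split.
- by move=> s' k' [v [X [_ _ _]]]; budget.
- move=> s' k' F [v [X [[vm Hlo] SS' Sc leK]]] /=.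
  rewrite Hlo (ss_end SS') ltn_pmul2r // -leqNgt => mv.
  have Ev : v = m by apply/eqP; rewrite eqn_leq vm.
  have Sm : scanned (L ++ X) i p m by move=> j _; apply: Sc; rewrite Ev ltn_ord.
  by apply: (HQ _ _ X) => //; move: leK; rewrite Ev subnn; budget.
- move=> s' k' F [v [X [[vm Hlo] SS' Sc leK]]] /=.
  rewrite Hlo (ss_end SS') ltn_pmul2r // => mv.
  pose j := Ordinal mv.
  have {}leK : ((m - v.+1) * 7 + 7 + 1 + (2 * m - size (L ++ X)) * visit_cost + K0 <= k')%N.
    by rewrite -(subnSK mv) in leK; budget.
  have Lip' : (i, p) \in L ++ X by rewrite mem_cat Lip.
  have scanS X' : scanned (L ++ X) i p v -> {subset L ++ X <= X'} ->
      ((i, j) \in edges1 G -> (j, ~~ p) \in X') -> scanned X' i p v.+1.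
    move=> Sc' sub Hj h; rewrite ltnS leq_eqVlt => /predU1P[Eh | hv] ih.
      have {}Eh : h = j by apply: val_inj.
      by rewrite Eh in ih *; apply: Hj.
    exact/sub/Sc'.
  (* The outcomes visit, already seen and no edge rejoin at the last instruction, where the
     invariant is restored. *)
  have fin s2 k2 X' : ireg s2 iHi = (v.+1 * r)%N -> search_state s2 (L ++ X') ->
      scanned (L ++ X') i p v.+1 ->
      ((m - v.+1) * 7 + 2 + (2 * m - size (L ++ X')) * visit_cost + K0 <= k2)%N ->
      wp (Do (IAdd iLo iHi iZero)) s2 k2 J.
    move=> Hhi SS2 Sc2 leK2; wp_instr; exists v.+1, X'; split.
    - by rewrite /= /upd /= Hhi (ss_0 SS2) addn0.
    - by apply: search_state_ext SS2 _ _ _ => //=; rewrite /upd /= !eqxx.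
    - by [].
    - by budget.
  wp_step; apply: wp_seq; set s1 := eval_step _ _ _.
  have Hhi : ireg s1 iHi = (v.+1 * r)%N.
    by rewrite /s1 /= /upd /= Hlo (ss_r SS') mulSn addnC.
  have SS1 : search_state s1 (L ++ X).
    by apply: search_state_ext SS' _ _ _ => //=; rewrite /upd /= !eqxx.
  have I1 y : y \in [:: iSrc; iPar; iOpp] -> ireg s1 y = ireg s y.
    rewrite !inE => /or3P[]/eqP->; by rewrite /s1 /= /upd /= (frame_ireg F).
  have Hlo1 : ireg s1 iLo = (j * r)%N by [].
  clearbody s1; apply: wp_if => /=; first by budget.
    rewrite I1 // s7 Hlo1 observed_corner // => ij.
    wp_step; set s2 := eval_step _ _ _.
    have SS2 : search_state s2 (L ++ X).
      by apply: search_state_ext SS1 _ _ _ => //=; rewrite /upd /= !eqxx.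
    have I2 y : y != iTmp -> ireg s2 y = ireg s1 y.
      by rewrite /s2 /= /upd => /negbTE->.
    have Htmp : ireg s2 iTmp = ((j, ~~ p) \in L ++ X).
      by rewrite /s2 /= /upd /= (I1 iOpp) // s9 Hlo1 (ss_seen SS1).
    clearbody s2; apply: wp_if => [|/=|/=]; first by budget.
      rewrite Htmp (ss_1 SS2) ltnS leqn0 eqb0 => Nj.
      (* Appending an unseen node keeps the list duplicate-free, and the double cover has 2m nodes,
         so the potential still covers this visit. *)
      have ltS : (size (L ++ X) < 2 * m)%N.
        have : uniq (rcons (L ++ X) (j, ~~ p)) by rewrite rcons_uniq Nj (ss_uniq SS1).
        move=> /card_uniqP; rewrite size_rcons => <-; apply: leq_trans (max_card _) _.
        by rewrite card_prod card_ord card_bool mulnC.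
      rewrite -(subnSK ltS) mulSn in leK.
      apply: (@wp_visit _ _ (L ++ X) i j p) => //; rewrite ?I2 ?(I1 iSrc) ?(I1 iPar) ?(I1 iOpp) //.
        by budget.
      move=> s3 k3 F3 SS3 lek3.
      apply: (fin _ _ (rcons X (j, ~~ p))).
      - by rewrite (frame_ireg F3) // I2.
      - by rewrite -rcons_cat.
      - by apply: scanS => // [x Hx | _]; rewrite -rcons_cat mem_rcons inE ?Hx ?orbT ?eqxx.
      - by rewrite -rcons_cat size_rcons; budget.
    rewrite Htmp (ss_1 SS2) ltnS leqn0 eqb0 negbK => Hj.
    apply: wp_skip; first by budget.
    by apply: (fin _ _ X) => //; [rewrite I2 | apply: scanS | budget].
  rewrite I1 // s7 Hlo1 observed_corner // => ij.
  apply: wp_skip; first by budget.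
  apply: (fin _ _ X) => //; last by budget.
  by apply: scanS => //; rewrite (negbTE ij).
Qed.

(** Two potentials pay for the search: 7m + 8 for each node still to be dequeued, and [visit_cost]
    for each node still to be enqueued. *)
Lemma wp_traverse s k L K0 Q :
  search_state s L -> ireg s iHead = 0%N ->
  (2 * m * (7 * m + 8) + 2 * m * visit_cost + 1 + K0 <= k)%N ->
  (forall s' k' L', frame Traverse s s' -> search_state s' L' ->
     (forall x, x \in L') -> (K0 <= k')%N -> Q s' k') ->
  wp Traverse s k Q.
Proof.
move=> SS Hh lek HQ.
pose J s' k' := exists L', [/\ search_state s' L', (ireg s' iHead <= size L')%N,
  forall t, (t < ireg s' iHead)%N ->
    scanned L' (nth (i0, false) L' t).1 (nth (i0, false) L' t).2 m
  & ((2 * m - ireg s' iHead) * (7 * m + 8) + (2 * m - size L') * visit_cost + 1 + K0 <= k')%N].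
apply: (@wp_while _ _ _ _ _ _ _ _ _ J).
- exists L; rewrite Hh; split=> //; rewrite subn0.
  apply: leq_trans lek; rewrite -!addnA leq_add2l leq_add2r leq_mul2r leq_subr.
  by rewrite orbT.
- by move=> s' k' [L' [_ _ _]]; budget.
- move=> s' k' F [L' [SS' hL Sc leK]] /=; rewrite (ss_tail SS') -leqNgt => Lh.
  apply: (HQ _ _ L') => //; last by budget.
  (* Once the head reaches the tail, every enqueued node has been scanned, so [L'] is closed under
     steps. *)
  apply: (double_cover_ind (S := mem L') (edges1_sym G) conG nbG (ss_start SS')).
  move=> h j q /= Hq hj; have lt := Hq; rewrite -index_mem in lt.
  have := Sc _ (leq_trans lt Lh); rewrite nth_index //=; apply=> //; exact: ltn_ord.
- move=> s' k' F [L' [SS' hL Sc leK]] /=; rewrite (ss_tail SS') => Lh.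
  set h := ireg s' iHead in hL Sc leK Lh.
  have hm := leq_trans Lh (search_size SS').
  have eh : (2 * m - h = (2 * m - h.+1).+1)%N by budget.
  rewrite eh mulSn in leK.
  have [q1 q2] := ss_queue SS' Lh.
  pose x := nth (i0, false) L' h.
  have Hx : x \in L' by apply: mem_nth.
  have {}leK : ((m * 7 + 1 + (2 * m - size L') * visit_cost +
      ((2 * m - h.+1) * (7 * m + 8) + 1 + K0 + 1)) + 5 <= k'.-1)%N.
    by budget.
  do 4!wp_step; apply: wp_seq; set s1 := eval_step _ _ _.
  have s1z : ireg s' iZero = 0%N := ss_0 SS'.
  have s1o : ireg s' iOne = 1%N := ss_1 SS'.
  apply: (@wp_scan _ _ L' x.1 x.2 ((2 * m - h.+1) * (7 * m + 8) + 1 + K0 + 1)).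
  + by apply: search_state_ext SS' _ _ _ => //=; rewrite /upd /= !eqxx.
  + by rewrite -surjective_pairing.
  + by rewrite /s1 /= /upd /= s1z -/h q1.
  + by rewrite /s1 /= /upd /= s1o -/h q2.
  + by rewrite /s1 /= /upd /= s1o -/h q2; case: (nth _ _ _).2.
  + by [].
  + by budget.
  move=> s2 k2 X F2 SS2 Sc2 leK2; wp_instr.
  have Hh2 : ireg s2 iHead = h by rewrite (frame_ireg F2).
  have Eh : ((upd (ireg s2) iHead (ireg s2 iHead + ireg s2 iOne)) iHead = h.+1)%N.
    by rewrite /upd /= Hh2 (ss_1 SS2) addn1.
  exists (L' ++ X); split.
  + by apply: search_state_ext SS2 _ _ _ => //=; rewrite /upd /= !eqxx.
  + by rewrite [ireg _ _]Eh size_cat; budget.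
  + rewrite [ireg _ _]Eh => t; rewrite ltnS leq_eqVlt => /predU1P[->|th].
      by rewrite nth_cat Lh.
    rewrite nth_cat (ltn_trans th Lh) => j jm ij.
    by rewrite mem_cat (Sc _ th j jm ij).
  + by rewrite [ireg _ _]Eh; budget.
Qed.

Lemma wp_solve_tail s k L Q :
  search_state s L -> (forall x, x \in L) -> (146 * r ^ 3 + 3 <= k)%N ->
  (forall s' k', (forall (q : bool) (l : 'I_n) (c : 'I_r), rarr s' q l c = T q l c) -> Q s' k') ->
  wp SolveTail s k Q.
Proof.
move=> SS HL lek HQ.
have [sn sr s0 s1 se] : [/\ ireg s iN = n, ireg s iR = r, ireg s iZero = 0%N,
  ireg s iOne = 1%N & ireg s iEnd = (m * r)%N] by case: SS.
have bnd : (m * r <= n <= m * r + r)%N.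
  by rewrite leq_divM /= -mulSnr ltnW // ltn_ceil.
do 3!wp_step; apply: wp_seq; set sa := eval_step _ _ _.
have ia : [/\ ireg sa iR = r, ireg sa iZero = 0%N, ireg sa iOne = 1%N & ireg sa iSrc = (i0 * r)%N].
  by rewrite i00; split.
have loa : ireg sa iLo = (m * r)%N by rewrite /sa /= /upd /= se s0 addn0.
have hia : ireg sa iHi = n by rewrite /sa /= /upd /= sn s0 addn0.
have tail_obs a (l : 'I_n) : (m * r <= l < n)%N -> (block_idx i0 a, l) \in Omega.
  by move=> /andP[Hl _]; apply: measured_tail.
case: ia => ir_ iz io isrc.
apply: (@wp_solve_factor false i0) => //; rewrite ?loa ?hia //.
  by budget.
  exact: (ss_known SS).
move=> sb kb Fb lekb Hin Hout.
(* Solving for the trailing rows leaves the block rows intact, so block 0 remains available to the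
   second solve. *)
have notin (j : 'I_m) (a : 'I_r) : ~~ (m * r <= j * r + a < n)%N.
  by rewrite negb_and -ltnNge block_idx_lt.
have known_b j q : rows_known sb j q.
  move=> a c; have K := ss_known SS (HL (j, q)) a c.
  by case: q K => K; rewrite ?Hout // (frame_rarr Fb).
apply: (@wp_solve_factor true i0) => //; rewrite ?(frame_ireg Fb) // ?loa ?hia //.
  by budget.
move=> sc kc Fc lekc Hin' Hout'; apply: HQ => q l c.
have [j a ->|Hl] := @indexP n r l.
  have K := known_b j q a c.
  by case: q K => K /=; rewrite ?Hout' // (frame_rarr Fc).
have Hl' : (m * r <= l < n)%N by rewrite Hl ltn_ord.
by case: q; [rewrite (frame_rarr Fc) //; apply: Hin | apply: Hin'].
Qed.

Lemma wp_compute_end s k Q : ireg s iN = n -> ireg s iR = r -> ireg s iZero = 0%N ->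
  ireg s iOne = 1%N -> ireg s iEnd = 0%N -> (3 * m + 3 <= k)%N ->
  (forall s' k', frame ComputeEnd s s' -> ireg s' iEnd = (m * r)%N ->
     (k <= k' + (3 * m + 3))%N -> Q s' k') ->
  wp ComputeEnd s k Q.
Proof.
move=> sn sr s0 s1 se lek HQ; have m_ge0 := leq0n m; apply: wp_frame; do 2!wp_step.
set sa := eval_step _ _ _.
pose J s' k' := exists v, [/\ (v <= m)%N, ireg s' iEnd = (v * r)%N, ireg s' iTmp = (v.+1 * r)%N,
  (3 * (m - v) + 1 <= k')%N & (k <= k' + (3 * v + 2))%N].
apply: (@wp_while _ _ _ _ _ _ _ _ _ J).
- exists 0%N; rewrite /sa /= /upd /= sr s0 se; split=> //; budget.
- by move=> s' k' [v [_ _ _]]; budget.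
- move=> s' k' F [v [vm He Ht l1 l2]] /=.
  rewrite Ht (frame_ireg F) //= /upd /= sn s1 addn1 -leqNgt -ltn_divLR // => H.
  have Ev : v = m by budget.
  by move=> Fr; apply: HQ => //; [rewrite He Ev | rewrite Ev in l2; budget].
- move=> s' k' F [v [vm He Ht l1 l2]] /=.
  rewrite Ht (frame_ireg F) //= /upd /= sn s1 addn1 ltnS -leq_divRL // => H.
  wp_step; wp_instr; exists v.+1; rewrite /= /upd /= Ht !(frame_ireg F) //= /upd /= s0 sr addn0.
  by split=> //; [rewrite [in RHS]mulSn addnC | budget | budget].
Qed.

Lemma wp_main k Q :
  (400 * (m * m + m * r ^ 3) <= k)%N ->
  (forall s' k', (forall (q : bool) (l : 'I_n) (c : 'I_r), rarr s' q l c = T q l c) -> Q s' k') ->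
  wp Main (init_state R n r) k Q.
Proof.
move=> lek HQ.
have m1 : (0 < m)%N by apply: leq_ltn_trans (ltn_ord i0).
have cost : (1 + (3 * m + 3) + (3 + (r * 3 + 2)) +
   (2 * m * (7 * m + 8) + 2 * m * visit_cost + 1) + (146 * r ^ 3 + 3) <= k)%N.
  exact: leq_trans (main_cost m1 r0) lek.
move: cost => {}lek.
wp_step; apply: wp_seq; apply: wp_compute_end => //; first by budget.
set s0 := eval_step _ _ _ => s1 k1 F1 He lek1.
apply: wp_seq; apply: wp_seq; apply: wp_do; first by budget.
set s2 := eval_step _ _ _; apply: wp_seq.
have I2 y : ~~ writes ComputeEnd IReg y -> ireg s2 y = ireg s0 y.
  by move=> Hy; rewrite /s2 /= (frame_ireg F1).
have [z1 z2 z3] : [/\ ireg s2 iZero = 0%N, ireg s2 iOne = 1%N & ireg s2 iR = r].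
  by rewrite !I2.
apply: (@wp_for _ _ _ _ _ _ _ _ 1 _ _ (fun v (rr : nat -> R)
   (ra : nat -> nat -> nat -> R) => rr xU = 1 /\ forall a c, ra 0%N a c = ((a == c) && (a < v)%N)%:R)) => //.
- by rewrite z1.
- rewrite z1 /s2 /= /upd /=; split=> // a c.
  by rewrite (frame_rarr F1) // andbF.
- by rewrite z1 z3; budget.
- move=> v s' k' F Ev Hv [Hu Ha] lek'; wp_instr; split; first by budget.
  split=> //= a c; rewrite upd_arrE /= Ev Hu Ha (ltnS a) (leq_eqVlt a v).
  by have [->|_] := eqVneq a v; rewrite ?ltnn ?andbF ?andbT /= 1?eq_sym; case: eqP.
rewrite z1 z3 subn0 => s3 k3 F3 [_ Ha] lek3.
wp_step; wp_instr; set s4 := eval_step _ _ _.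
(* The search starts from (i0, false), whose row block in T_0 is the identity just stored; the
   reserve is the cost of [SolveTail]. *)
apply: wp_seq; apply: (@wp_traverse _ _ [:: (i0, false)] (146 * r ^ 3 + 3)).
- have I3 y : y \in [:: iN; iR; iZero; iOne] -> ireg s4 y = ireg s0 y.
    by rewrite !inE => /or4P[]/eqP->; rewrite /s4 /= /upd /= (frame_ireg F3) ?I2.
  have A3 y : iarr s3 y = iarr s0 y.
    by rewrite (frame_iarr F3) //= (frame_iarr F1).
  have [y1 y2] : ireg s3 2 = 0%N /\ ireg s3 3 = 1%N by rewrite !(frame_ireg F3).
  split=> //; rewrite ?(I3 iN) ?(I3 iR) ?(I3 iZero) ?(I3 iOne) ?mem_head //.
  + by rewrite /s4 /= /upd /= (frame_ireg F3).
  + by rewrite /s4 /= /upd /= y1 y2.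
  + case=> // _; rewrite /s4 /= !upd_arrE /= A3 i00 mul0n //.
  + move=> j q; rewrite /s4 /= upd_arrE /= y1 y2 A3 inE xpair_eqE.
    rewrite -[j == i0]/((j : nat) == i0) i00 muln_eq0 (gtn_eqF r0) orbF.
    by case: (_ == _) q => [] [].
  + move=> j q; rewrite inE => /eqP[-> ->] a c; rewrite /s4 /= Ha i00 mul0n add0n ltn_ord andbT.
    by case: NT => _ /matrixP/(_ a c); rewrite !mxE => ->.
- by rewrite /s4 /= /upd /= (frame_ireg F3) ?I2.
- by budget.
move=> s5 k5 L F5 SS5 HL lek5; exact: wp_solve_tail SS5 HL lek5 HQ.
Qed.

End Main.

(** * Uniqueness and running time together *)

Theorem proposition1 (R : realType) :
  exists (p : program) (C : nat),
    forall (n r : nat) (G : graph_pair (n %/ r)%N) (Mstar : 'M[R]_n)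
           (Omega : {set 'I_n * 'I_n}),
      (1 <= r)%N -> (2 * r <= n)%N ->
      low_complexity G Mstar Omega ->
      unique (solution Mstar Omega r) Mstar /\
      exists t : nat,
        finds_in r p Omega Mstar t /\
        t%:R <= C%:R * (n%:R ^+ 2 / r%:R ^+ 2 + n%:R * r%:R ^+ 2) :> R.
Proof.
exists Main, 400%N => n r G M Omega r0 n2 LC.
have m0 : (0 < n %/ r)%N by rewrite divn_gt0 //; lia.
split; first exact: low_complexity_unique LC.
case: LC => [[psdM rkM] rkB -> conG nbG].
pose i0 := Ordinal m0.
have [T NT] : exists T, normalized_factors M i0 T.
  by apply: (@normalized_factors_exist _ _ _ _ _ i0); rewrite ?rkM.
have [t [s [E lek HT]]] := wp_main r0 (erefl : i0 = 0%N :> nat) psdM.1 rkB NT conG nbG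
  (leqnn _) (fun s' _ (H : forall (q : bool) (l : 'I_n) (c : 'I_r), rarr s' q l c = T q l c) => H).
exists t; split.
  exists s; split=> //.
  have out q : output_mx n r (nat_of_bool q) s = T q.
    by apply/matrixP => l c; rewrite mxE HT.
  by rewrite -NT.1 -(out false) -(out true).
set m := (n %/ r)%N in lek.
(* From m r <= n follow m^2 <= (n/r)^2 and m r^3 = (m r) r^2 <= n r^2. *)
have mr : (m%:R * r%:R <= n%:R :> R) by rewrite -natrM ler_nat leq_divM.
have rp : 0 < r%:R :> R by rewrite ltr0n.
apply: (@le_trans _ _ (400 * (m * m + m * r ^ 3))%:R); first by rewrite ler_nat; budget.
rewrite natrM ler_wpM2l ?ler0n // natrD !(natrM _ m) natrX; apply: lerD.
  rewrite -expr2 -expr_div_n ler_pXn2r ?nnegrE ?divr_ge0 ?ler0n //.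
  by rewrite ler_pdivlMr.
by rewrite exprS mulrA ler_wpM2r // exprn_ge0 // ltW.
Qed.
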